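(* Let $d\ge3$ and $D=\min\{2^{d-1},2d(d-1)\}$. For any real $s>(s(d)D-d^2-1)/2$ and any $\delta$ with $N^{-(d+1)/(2(2s+d^2+1))}\le\delta\le1$, we have $$I^\sharp_{s,d}(\delta;N)\le\delta^dN^{2s(1-s(d)/(2s+d^2+1))+o(1)}.$$
   Context: For integers $d,N\ge1$ and $\mathbf x=(x_1,\dots,x_d)\in\mathsf T_d=[0,1)^d$ (identified with $(\mathbb R/\mathbb Z)^d$), let $S_d(\mathbf x;N)=\sum_{n=1}^N\exp\bigl(2\pi i(x_1n+\dots+x_dn^d)\bigr)$. For real $s>0$, $\delta\in(0,1]$ and $\boldsymbol\xi\in\mathsf T_d$, let $I_{s,d}(\delta,\boldsymbol\xi;N)=\int_{\boldsymbol\xi+[0,\delta]^d}|S_d(\mathbf x;N)|^{2s}d\mathbf x$ (the integrand is 1-periodic in each coordinate), and $I^\sharp_{s,d}(\delta;N)=\sup_{\boldsymbol\xi\in\mathsf T_d}I_{s,d}(\delta,\boldsymbol\xi;N)$. Write $s(d)=d(d+1)/2$. A bound $X\le N^{c+o(1)}$ means: for every $\varepsilon>0$ there is $N_0$ depending only on $\varepsilon,d,s$ such that $X\le N^{c+\varepsilon}$ for all $N\ge N_0$, uniformly in $\delta$. *)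

(* Defs.v *)
From HB Require Import structures.
From mathcomp Require Import all_boot all_order all_algebra.
From mathcomp Require Import complex.
From mathcomp Require Import all_classical all_reals all_analysis.

Set Implicit Arguments.
Unset Strict Implicit.
Unset Printing Implicit Defensive.

Import Order.TTheory GRing.Theory Num.Theory.
Import numFieldNormedType.Exports.

Local Open Scope classical_set_scope.
Local Open Scope ring_scope.

Section tuple_measure_cons.
Local Open Scope ereal_scope.
Context (d : measure_display) (T : measurableType d) (R : realType) (n : nat).
Variable m1 : {sigma_finite_measure set T -> \bar R}.
Variable m2 : {sigma_finite_measure set (n.-tuple T) -> \bar R}.

Definition tuple_of_pair (p : T * n.-tuple T) : n.+1.-tuple T :=
  [tuple of p.1 :: p.2].

Lemma measurable_tuple_of_pair : measurable_fun setT tuple_of_pair.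
Proof. by apply: measurable_cons. Qed.

Definition tuple_measure_cons : set (n.+1.-tuple T) -> \bar R :=
  pushforward (m1 \x m2) tuple_of_pair.

Let tuple_measure_cons0 : tuple_measure_cons set0 = 0.
Proof. by rewrite /tuple_measure_cons /pushforward preimage_set0 measure0. Qed.

Let tuple_measure_cons_ge0 A : 0 <= tuple_measure_cons A.
Proof. exact: (measure_ge0 (m1 \x m2)). Qed.

Let measurable_preimage A : measurable A -> measurable (tuple_of_pair @^-1` A).
Proof.
by move=> mA; rewrite -[X in measurable X]setTI; exact: measurable_tuple_of_pair.
Qed.

Let tuple_measure_cons_sigma_additive : semi_sigma_additive tuple_measure_cons.
Proof.
move=> F mF tF mUF; rewrite /tuple_measure_cons /pushforward preimage_bigcup.
apply: measure_semi_sigma_additive.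
- by move=> k; exact: measurable_preimage.
- apply/trivIsetP => /= i j _ _ ij; rewrite -preimage_setI.
  by move/trivIsetP : tF => /(_ _ _ _ _ ij) ->//; rewrite preimage_set0.
- by rewrite -preimage_bigcup; exact: measurable_preimage.
Qed.

HB.instance Definition _ := isMeasure.Build _ _ _ tuple_measure_cons
  tuple_measure_cons0 tuple_measure_cons_ge0 tuple_measure_cons_sigma_additive.

Let tuple_measure_cons_sigma_finite : sigma_finite setT tuple_measure_cons.
Proof.
have /sigma_finiteP[F [TF ndF Foo]] := sigma_finiteT m1.
have /sigma_finiteP[G [TG ndG Goo]] := sigma_finiteT m2.
exists (fun k => [set t | F k (thead t) /\ G k [tuple of behead t]]).
  apply/seteqP; split=> // t _.
  have [i _ Fi] : (\bigcup_k F k) (thead t) by rewrite -TF.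
  have [j _ Gj] : (\bigcup_k G k) [tuple of behead t] by rewrite -TG.
  exists (maxn i j) => //; split.
    by move: Fi; exact/subsetPset/ndF/leq_maxl.
  by move: Gj; exact/subsetPset/ndG/leq_maxr.
move=> k; have [mF Fk] := Foo k; have [mG Gk] := Goo k; split.
  rewrite (_ : [set t | _] =
    (fun t : n.+1.-tuple T => tnth t ord0) @^-1` (F k) `&`
    (fun t : n.+1.-tuple T => [tuple of behead t]) @^-1` (G k))//.
  apply: measurableI; rewrite -[X in measurable X]setTI.
    exact: measurable_tnth.
  exact: measurable_behead.
rewrite /tuple_measure_cons /pushforward (_ : _ @^-1` _ = F k `*` G k).
  by rewrite product_measure1E// lte_mul_pinfty// ge0_fin_numE.
have beheadK (x : T) (t : n.-tuple T) :
    [tuple of behead (tuple_of_pair (x, t))] = t by exact/val_inj.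
by apply/seteqP; split=> -[x t] /=; rewrite theadE beheadK.
Qed.

HB.instance Definition _ := Measure_isSigmaFinite.Build _ _ _ tuple_measure_cons
  tuple_measure_cons_sigma_finite.

End tuple_measure_cons.

(* The n-fold product measure m x ... x m on n.-tuple T, which the library
   equips with its product sigma-algebra: the unit mass when n = 0, then
   m x m^n transported along T x T^n -> T^(n+1). *)
Fixpoint power_measure (d : measure_display) (T : measurableType d)
    (R : realType) (m : {sigma_finite_measure set T -> \bar R}) (n : nat) :
    {sigma_finite_measure set (n.-tuple T) -> \bar R} :=
  match n with
  | 0 => \d_([tuple] : 0.-tuple T)
  | k.+1 => tuple_measure_cons m (power_measure m k)
  end.

Definition lebesgue_tuple (R : realType) (n : nat) :
    {sigma_finite_measure set (n.-tuple (measurableTypeR R)) -> \bar R} :=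
  power_measure (@lebesgue_measure R) n.

(* The box volume formula, which characterizes Lebesgue measure. *)
Lemma lebesgue_tuple_box (R : realType) (n : nat) (a b : n.-tuple R) :
  (forall i, tnth a i <= tnth b i) ->
  lebesgue_tuple R n [set x | forall i, tnth a i <= tnth x i <= tnth b i] =
  (\prod_(i < n) (tnth b i - tnth a i))%:E.
Proof.
have tnth_lift (T : Type) k (t : k.+1.-tuple T) (j : 'I_k) :
    tnth t (lift ord0 j) = tnth [tuple of behead t] j.
  by rewrite [in LHS](tuple_eta t) tnthS.
elim: n a b => [|n IHn] a b ab.
  by rewrite big_ord0 /lebesgue_tuple /= diracE mem_set//= => -[].
rewrite /lebesgue_tuple /= /tuple_measure_cons /pushforward.
pose B : set (n.-tuple (measurableTypeR R)) :=
  [set x | forall i, tnth [tuple of behead a] i <= tnth x i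
                     <= tnth [tuple of behead b] i].
have mB : measurable B.
  rewrite (_ : B = \bigcap_(i in [set: 'I_n])
    ((fun x : n.-tuple (measurableTypeR R) => tnth x i) @^-1`
      `[tnth [tuple of behead a] i, tnth [tuple of behead b] i])).
    apply: fin_bigcap_measurable => // i _.
    rewrite -[X in measurable X]setTI; exact: measurable_tnth.
  apply/seteqP; split => x /= H i.
    by move=> _; have := H i; rewrite /= in_itv.
  by have := H i Logic.I; rewrite /= in_itv.
rewrite (_ : _ @^-1` _ = `[thead a, thead b] `*` B); last first.
  have beheadK (x : R) (t : n.-tuple R) :
    [tuple of behead (tuple_of_pair (x, t))] = t by exact/val_inj.
  apply/seteqP; split=> -[x t] /=.
    move=> H; split; first by have := H ord0; rewrite /= in_itv /= /thead tnth0.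
    by move=> i; have := H (lift ord0 i); rewrite !tnth_lift beheadK.
  rewrite in_itv /= => -[H0 H] i.
  case: (unliftP ord0 i) => [j|] ->; last by rewrite tnth0.
  by rewrite !tnth_lift beheadK; exact: H.
transitivity (@lebesgue_measure R `[thead a, thead b]%classic *
              power_measure (@lebesgue_measure R) n B)%E.
  exact: (product_measure1E (@lebesgue_measure R)).
have -> : power_measure (@lebesgue_measure R) n B =
    (\prod_(i < n) (tnth [tuple of behead b] i - tnth [tuple of behead a] i))%:E.
  by rewrite -IHn// => i; rewrite -!tnth_lift.
rewrite lebesgue_measure_itv/= lte_fin big_ord_recl EFinM; congr (_ * _)%E.
  have := ab ord0; rewrite /thead le_eqVlt => /predU1P[->|->].
    by rewrite ltxx subrr.
  by rewrite EFinB.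
by congr EFin; apply: eq_bigr => i _; rewrite !tnth_lift.
Qed.

Section mean_values.
Context {R : realType}.
Local Open Scope complex_scope.

(* exp(2 pi i t), by Euler's formula: the libraries have no complex exponential *)
Definition expi2pi (t : R) : R[i] :=
  cos (2 * pi * t) +i* sin (2 * pi * t).

(* [0, 1)^d, as a set of representatives of (R/Z)^d *)
Definition torus (d : nat) : set (d.-tuple R) :=
  [set x | forall j, 0 <= tnth x j < 1].

Definition weyl_sum (d : nat) (x : d.-tuple R) (N : nat) : R[i] :=
  \sum_(1 <= n < N.+1) expi2pi (\sum_(j < d) tnth x j * n%:R ^+ j.+1).

(* xi + [0, delta]^d; it may leave [0, 1)^d, but weyl_sum is defined on all of
   R^d and is 1-periodic in each coordinate *)
Definition cube (d : nat) (xi : d.-tuple R) (delta : R) : set (d.-tuple R) :=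
  [set x | forall j, tnth xi j <= tnth x j <= tnth xi j + delta].

Definition local_mean_value (s : R) (d : nat) (delta : R) (xi : d.-tuple R)
    (N : nat) : \bar R :=
  \int[lebesgue_tuple R d]_(x in cube xi delta)
    (ComplexField.Normc.normc (weyl_sum x N) `^ (2 * s))%:E.

Definition sup_local_mean_value (s : R) (d : nat) (delta : R) (N : nat) :
    \bar R :=
  ereal_sup [set local_mean_value s delta xi N | xi in @torus d].

End mean_values.

Definition s_of (R : realType) (d : nat) : R := d%:R * (d%:R + 1) / 2.

(* Main.v *)
Require Import Defs.
From HB Require Import structures.
From mathcomp Require Import all_boot all_order all_algebra complex.
From mathcomp Require Import all_classical all_reals all_analysis.
From mathcomp Require Import measurable_realfun.
From mathcomp Require Import zify ring lra.

(* By monotonicity it is enough to bound the mean value over a unit cube by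
   N^(2s - s(d) + d^2 kappa), where kappa = s(d) / (2s + d^2 + 1): the lower
   bound on delta says exactly that delta^d >= N^(-kappa).  The range of s is so
   far to the right that, instead of large-value estimates on major arcs, the
   classical Vinogradov mean value theorem
     J_{kd,d}(N) << N^(2kd - s(d) + (d^2/2)(1 - 1/d)^k)
   is strong enough: for d >= 4 one takes k = floor(s/d), and for d = 3 and
   7 < s <= 9 one interpolates between k = 2 and k = 3.

   The mean value theorem is proved by induction on k.  Fix a large prime l and
   split the sum into residue classes mod l.  At each point, either one class
   dominates, which reproduces the same mean value at N/l with a gain, or d
   distinct classes are all large.  In the second case the remaining 2kd factors
   are restricted by Hoelder's inequality to a single class mod q = l^m, with q
   about N^(1/d), and the d distinct factors are counted by Linnik's lemma.  All
   moments are averages over translates of the finite grid (Z/M)^d; the integral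
   is compared with such an average because the sum varies by at most 1 on the
   cells of a fine grid. *)

Set Implicit Arguments.
Unset Strict Implicit.
Unset Printing Implicit Defensive.

Import Order.TTheory GRing.Theory Num.Theory.
Import numFieldNormedType.Exports.
Import ComplexField.Normc.

Local Open Scope ring_scope.

(** * Power sums modulo prime powers *)

Lemma eqn_mod_dvdz (m n d : nat) :
  (m == n %[mod d])%N = (d%:Z %| m%:Z - n%:Z)%Z.
Proof. by rewrite -eqz_mod_dvd !modz_nat. Qed.

Lemma Fp_nat_eq (l m n : nat) :
  prime l -> (m%:R == n%:R :> 'F_l) = (m == n %[mod l])%N.
Proof.
move=> pl; rewrite eqn_mod_dvdz (dvdz_pcharf (pchar_Fp pl)).
by rewrite rmorphB /= subr_eq0 !pmulrn.
Qed.

(* The differences [X i - Y i] solve the linear system with matrix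
   [C j i = (X i ^ (j+1) - Y i ^ (j+1)) / (X i - Y i)], which is congruent
   modulo l to [(j+1) X i ^ j], a row-scaled Vandermonde matrix. *)
Lemma power_sums_lift (d l T : nat) (x y : 'I_d -> nat) :
  prime l -> (d < l)%N ->
  (forall i, x i = y i %[mod l])%N ->
  (forall i i', x i = x i' %[mod l] -> i = i')%N ->
  (forall j : 'I_d, \sum_i x i ^ j.+1 = \sum_i y i ^ j.+1 %[mod l ^ T])%N ->
  forall i, (x i = y i %[mod l ^ T])%N.
Proof.
move=> pl dl xy xinj sxy i.
pose C : 'M[int]_d :=
  \matrix_(j, i) \sum_(s < j.+1) (x i)%:Z ^+ (j - s) * (y i)%:Z ^+ s.
pose D : 'cV[int]_d := \col_i ((x i)%:Z - (y i)%:Z).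
have CD j : ((l ^ T)%:Z %| (C *m D) j ord0)%Z.
  rewrite mxE (_ : \sum_i _ =
    (\sum_i x i ^ j.+1)%N%:Z - (\sum_i y i ^ j.+1)%N%:Z).
    by rewrite -eqn_mod_dvdz; apply/eqP; exact: sxy.
  rewrite -!natz !natr_sum -sumrB; apply: eq_bigr => k _.
  by rewrite !mxE mulrC -subrXX !natrX !natz.
(* [det C] is prime to [l]: the Vandermonde factor because the [x i] are distinct mod [l], the row
   factors [j + 1] because [d < l]. *)
have detC : coprimez (l ^ T)%:Z (\det C).
  rewrite coprimezE absz_nat coprimeXl // prime_coprime //.
  have -> : (l %| `|\det C|)%N = (l%:Z %| \det C)%Z by rewrite dvdzE.
  rewrite (dvdz_pcharf (pchar_Fp pl)) -det_map_mx /=.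
  pose V := Vandermonde d (\row_i (x i)%:R : 'rV['F_l]_d).
  have -> : map_mx intr C = diag_mx (\row_j j.+1%:R) *m V.
    apply/matrixP => j k; rewrite mul_diag_mx !mxE rmorph_sum /=.
    rewrite (eq_bigr (fun=> (x k)%:R ^+ j)).
      by rewrite sumr_const card_ord mulr_natl.
    move=> s _; rewrite rmorphM /= !rmorphXn /= -!pmulrn.
    have /eqP -> : (y k)%:R == (x k)%:R :> 'F_l by rewrite Fp_nat_eq // xy.
    by rewrite -exprD subnK // -ltnS.
  rewrite det_mulmx det_diag det_Vandermonde mulf_neq0 //.
    apply/prodf_neq0 => j _; rewrite mxE -(dvdn_pcharf (pchar_Fp pl)).
    by apply/negP => /dvdn_leq -/(_ isT); have := ltn_ord j; lia.
  apply/prodf_neq0 => j _; apply/prodf_neq0 => k jk; rewrite !mxE subr_eq0.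
  rewrite Fp_nat_eq //; apply/negP => /eqP /xinj kj.
  by move: jk; rewrite kj ltnn.
apply/eqP; rewrite eqn_mod_dvdz -(Gauss_dvdzr _ detC).
have -> : \det C * ((x i)%:Z - (y i)%:Z) = (\adj C *m (C *m D)) i ord0.
  by rewrite mulmxA mul_adj_mx mul_scalar_mx !mxE.
by rewrite mxE; apply: rpred_sum => j _; apply: dvdz_mull.
Qed.

(** Translation-dilation invariance: by the binomial theorem one family of power sums is a
    triangular transform of the other with diagonal [q ^ j], inverted by strong induction on [j].
    Degree 0 is included to close the system. *)
Lemma power_sums_affine (I : finType) (d a q : nat) (z w : I -> nat) :
  (0 < q)%N ->
  (forall j, (j <= d)%N ->
     \sum_i (a + q * z i) ^ j = \sum_i (a + q * w i) ^ j)%N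
  <-> (forall j, (j <= d)%N -> \sum_i (z i) ^ j = \sum_i (w i) ^ j)%N.
Proof.
have E j (u : I -> nat) : (\sum_i (a + q * u i) ^ j =
    \sum_(t < j.+1) 'C(j, t) * (a ^ (j - t) * q ^ t) * \sum_i u i ^ t)%N.
  rewrite (eq_bigr (fun i => \sum_(t < j.+1)
     'C(j, t) * (a ^ (j - t) * q ^ t) * u i ^ t)%N).
    by rewrite exchange_big; apply: eq_bigr => t _; rewrite big_distrr.
  move=> i _; rewrite expnDn; apply: eq_bigr => t _.
  by rewrite expnMn; ring.
move=> q0; split=> H j; last first.
  move=> jd; rewrite !E; apply: eq_bigr => t _.
  by rewrite H //; have := ltn_ord t; lia.
elim/ltn_ind: j => j IH jd; have := H j jd.
rewrite !E !big_ord_recr /= (eq_bigr (fun t : 'I_j =>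
    'C(j, t) * (a ^ (j - t) * q ^ t) * \sum_i w i ^ t)%N).
  move=> /addnI /eqP; rewrite eqn_pmul2l; first by move/eqP.
  by rewrite binn subnn expn0 !mul1n expn_gt0 q0.
by move=> t _; rewrite IH //; have := ltn_ord t; lia.
Qed.

Lemma card_ord_lt (n m : nat) : (#|[pred u : 'I_n | u < m]| <= m)%N.
Proof.
rewrite cardE -(size_map val) -[leqRHS](size_iota 0) uniq_leq_size //.
  by rewrite map_inj_uniq ?enum_uniq //; exact: val_inj.
by move=> _ /mapP[u + ->]; rewrite mem_enum mem_iota inE.
Qed.

(* Linnik's lemma. *)
Lemma card_congruent_power_sums (d l m N a : nat) (b t : 'I_d -> nat) :
  prime l -> (d < l)%N -> (N <= (l ^ m) ^ d)%N ->
  (forall i i', b i = b i' %[mod l] -> i = i')%N ->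
  (#|[set x : {ffun 'I_d -> 'I_N} | [forall i, x i == b i %[mod l]] &&
       [forall j : 'I_d, \sum_i (x i + a) ^ j.+1 == t j %[mod (l ^ m) ^ j.+1]]]|
   <= (l ^ m) ^ 'C(d, 2))%N.
Proof.
move=> pl dl Nq binj; set q := (l ^ m)%N; set S := [set x | _].
have q0 n : (0 < q ^ n)%N by rewrite !expn_gt0 prime_gt0.
(* The power sums mod [q ^ d] determine [x]. Their residues mod [q ^ j.+1] are prescribed, so [f]
   records only the quotients, of which [q ^ (d - j.+1)] are possible; these exponents add up to
   ['C(d, 2)]. *)
pose r (x : {ffun 'I_d -> 'I_N}) j :=
  ((\sum_i (x i + a) ^ j.+1) %% q ^ d)%N.
pose f (x : {ffun 'I_d -> 'I_N}) : {ffun 'I_d -> 'I_(q ^ d).+1} :=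
  [ffun j : 'I_d => inord (r x j %/ q ^ j.+1)].
have rlt x j : (j < d)%N -> (r x j %/ q ^ j.+1 < q ^ (d - j.+1))%N.
  by move=> jd; rewrite ltn_divLR // -expnD subnK // ltn_pmod.
have rlt' x j : (r x j %/ q ^ j.+1 < (q ^ d).+1)%N.
  by rewrite ltnS (leq_trans (leq_div _ _)) // ltnW // ltn_pmod.
have finj : {in S &, injective f}.
  move=> x y; rewrite !inE => /andP[/forallP xb /forallP xt].
  move=> /andP[/forallP yb /forallP yt] fxy; apply/ffunP => i; apply/val_inj.
  have xy : (x i + a = y i + a %[mod l ^ (m * d)])%N.
    apply: (@power_sums_lift d l (m * d) (fun i => x i + a)%N
              (fun i => y i + a)%N) => //.
    - by move=> k; apply/eqP; rewrite eqn_modDr (eqP (xb k)) eq_sym yb.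
    - move=> k k' /eqP; rewrite eqn_modDr (eqP (xb k)) (eqP (xb k')) => /eqP.
      exact: binj.
    - move=> j; rewrite expnM -/(r x j) -/(r y j).
      rewrite (divn_eq (r x j) (q ^ j.+1)) (divn_eq (r y j) (q ^ j.+1)).
      congr (_ * _ + _)%N.
        have /ffunP /(_ j) := fxy; rewrite !ffunE => /(congr1 val).
        by rewrite /= !inordK.
      rewrite /r !modn_dvdm ?dvdn_exp2l //.
      by rewrite (eqP (xt j)) (eqP (yt j)).
  move/eqP: xy; rewrite eqn_modDr expnM !modn_small ?(leq_trans _ Nq) //.
  by move/eqP.
pose F (j : 'I_d) := [pred u : 'I_(q ^ d).+1 | (u < q ^ (d - j.+1))%N].
rewrite -(card_in_imset finj) (leq_trans (n := #|family F|)) //.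
  apply/subset_leq_card/fintype.subsetP => _ /imsetP[x _ ->].
  by apply/familyP => j; rewrite ffunE inE /= inordK // rlt.
rewrite card_family foldrE big_map big_enum /=.
rewrite (leq_trans (n := \prod_(j < d) q ^ (d - j.+1))) //.
  by apply: leq_prod => j _; exact: card_ord_lt.
rewrite -expn_sum leq_pexp2l ?(q0 1) // (reindex_inj rev_ord_inj) /=.
rewrite -bin2_sum big_mkord leq_sum // => j _.
by have := ltn_ord j; lia.
Qed.

(** * Characters of translated grids *)

Section expi.
Context {R : realType}.
Local Open Scope complex_scope.

#[local] Arguments expi2pi : simpl never.

Lemma expi2piD (t u : R) : expi2pi (t + u) = expi2pi t * expi2pi u.
Proof.
rewrite /expi2pi mulrDr cosD sinD; apply/eqP; rewrite eq_complex /=.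
by apply/andP; split; apply/eqP; ring.
Qed.

Lemma expi2pi0 : expi2pi (0 : R) = 1.
Proof. by rewrite /expi2pi mulr0 cos0 sin0. Qed.

Lemma expi2pi_sum (I : Type) (r : seq I) (P : pred I) (f : I -> R) :
  expi2pi (\sum_(i <- r | P i) f i) = \prod_(i <- r | P i) expi2pi (f i).
Proof. exact: (big_morph _ expi2piD expi2pi0). Qed.

Lemma expi2piN (t : R) : expi2pi (- t) = (expi2pi t)^*.
Proof. by rewrite /expi2pi mulrN cosN sinN. Qed.

Lemma normc_expi2pi (t : R) : normc (expi2pi t) = 1.
Proof. by rewrite /normc /= cos2Dsin2 sqrtr1. Qed.

Lemma expi2pi_nat (n : nat) : expi2pi (n%:R : R) = 1.
Proof.
have e1 : expi2pi (1 : R) = 1.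
  by rewrite /expi2pi mulr1 mulr_natl cos2pi sin2pi.
elim: n => [|n IH]; first exact: expi2pi0.
by rewrite -natr1 expi2piD IH e1 mulr1.
Qed.

(** The real part is [1 - 2 sin^2 (pi t)], and the sine is positive strictly between 0 and [pi]. *)
Lemma expi2pi_neq1 (t : R) : 0 < t < 1 -> expi2pi t != 1.
Proof.
rewrite /expi2pi => /andP[t0 t1].
apply/negP => /eqP /(congr1 (@complex.Re R)) /=.
have -> : 2 * pi * t = (pi * t) *+ 2 by rewrite -mulr_natl; ring.
rewrite cos_mulr2n -mulr_natl cos2sin2.
have : 0 < sin (pi * t).
  by apply: sin_gt0_pi; rewrite mulr_gt0 ?pi_gt0 //= gtr_pMr ?pi_gt0.
move=> s0 /eqP; apply/negP; rewrite -subr_eq0.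
have -> : 2 * (1 - sin (pi * t) ^+ 2) - 1 - 1 = - (2 * sin (pi * t) ^+ 2).
  by ring.
by rewrite oppr_eq0 mulf_neq0 // ?expf_neq0 // gt_eqF.
Qed.

Lemma normc_ge0 (z : R[i]) : 0 <= normc z.
Proof. by case: z => a b; rewrite sqrtr_ge0. Qed.

Lemma normc_sqr (z : R[i]) : ((normc z) ^+ 2)%:C = z * z^*.
Proof.
case: z => a b; rewrite /normc sqr_sqrtr ?addr_ge0 ?sqr_ge0 //.
by apply/eqP; rewrite eq_complex /=; apply/andP; split; apply/eqP; ring.
Qed.

Lemma normcX (z : R[i]) n : normc (z ^+ n) = normc z ^+ n.
Proof. by elim: n => [|n IH]; rewrite ?expr0 ?normc1 // !exprS normcM IH. Qed.

Lemma normc_prod (I : Type) (r : seq I) (P : pred I) (f : I -> R[i]) :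
  normc (\prod_(i <- r | P i) f i) = \prod_(i <- r | P i) normc (f i).
Proof. exact: (big_morph _ (@normcM R) (@normc1 R)). Qed.

Lemma le_normc_sum (I : Type) (r : seq I) (P : pred I) (f : I -> R[i]) :
  normc (\sum_(i <- r | P i) f i) <= \sum_(i <- r | P i) normc (f i).
Proof.
elim/big_ind2: _ => //; first by rewrite normc0.
by move=> a b c e ab ce; rewrite (le_trans (le_normcD _ _)) // lerD.
Qed.

End expi.

Section grid.
Context {R : realType} (d M : nat) (xi : 'I_d -> R).
Hypothesis M0 : (0 < M)%N.
#[local] Arguments expi2pi : simpl never.
Local Open Scope complex_scope.
Local Notation grid := {ffun 'I_d -> 'I_M}.

(* The character with frequency [h] on the translate [xi + (Z/M)^d] of the grid
   of mesh [1/M]. *)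
Definition gridchar (al : grid) (h : 'I_d -> nat) : R[i] :=
  expi2pi (\sum_j (xi j + (al j)%:R / M%:R) * (h j)%:R).

Lemma gridcharD al g h :
  gridchar al (fun j => g j + h j)%N = gridchar al g * gridchar al h.
Proof.
rewrite /gridchar -expi2piD -big_split /=; congr expi2pi.
by apply: eq_bigr => j _; rewrite natrD mulrDr.
Qed.

Lemma gridchar_sum (I : finType) al (h : I -> 'I_d -> nat) :
  gridchar al (fun j => \sum_i h i j)%N = \prod_i gridchar al (h i).
Proof.
rewrite /gridchar -expi2pi_sum exchange_big /=; congr expi2pi.
by apply: eq_bigr => j _; rewrite natr_sum mulr_sumr.
Qed.

Lemma normc_gridchar al h : normc (gridchar al h) = 1.
Proof. exact: normc_expi2pi. Qed.

Lemma sum_roots1 (t : R) : expi2pi (M%:R * t) = 1 -> expi2pi t != 1 ->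
  \sum_(a < M) expi2pi (a%:R * t) = 0 :> R[i].
Proof.
move=> tM t1.
have E n : expi2pi (n%:R * t) = expi2pi t ^+ n.
  elim: n => [|n IH]; first by rewrite mul0r expi2pi0.
  by rewrite -natr1 mulrDl mul1r expi2piD IH exprSr.
under eq_bigr do rewrite E.
apply: (mulfI (x := expi2pi t - 1)); first by rewrite subr_eq0.
by rewrite -subrX1 -E tM subrr mulr0.
Qed.

(** For [n < m] the phase [(m - n) / M] lies strictly between 0 and 1 and the geometric sum
    vanishes; the case [m < n] is its conjugate. *)
Lemma sum_gridchar1 (m n : nat) : (m < M)%N -> (n < M)%N ->
  \sum_(a < M) expi2pi (a%:R * ((m%:R - n%:R) / M%:R) : R) =
  if m == n then M%:R else 0.
Proof.
have Mr0 : M%:R != 0 :> R by rewrite pnatr_eq0 -lt0n.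
have key m' n' : (m' < M)%N -> (n' < m')%N ->
    \sum_(a < M) expi2pi (a%:R * ((m'%:R - n'%:R) / M%:R) : R) = 0.
  move=> mM nm; apply: sum_roots1.
    by rewrite mulrC divfK // -natrB ?expi2pi_nat // ltnW.
  apply: expi2pi_neq1; rewrite -natrB 1?ltnW //.
  rewrite divr_gt0 ?ltr0n ?subn_gt0 // ltr_pdivrMr ?ltr0n // mul1r ltr_nat.
  by rewrite (leq_ltn_trans _ mM) // leq_subr.
move=> mM nM; case: ltngtP => [mn|nm|->]; last 2 first.
- exact: key.
- under eq_bigr do rewrite subrr mul0r mulr0 expi2pi0.
  by rewrite sumr_const card_ord.
transitivity ((\sum_(a < M) expi2pi (a%:R * ((n%:R - m%:R) / M%:R) : R))^*).
  rewrite rmorph_sum; apply: eq_bigr => a _.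
  by rewrite -[RHS]/((expi2pi _)^*) -expi2piN -mulrN -mulNr opprB.
by rewrite key // conjc0.
Qed.

(** The sum factors over the coordinates. The translate [xi] contributes only a unimodular phase,
    which is 1 when [g] and [h] agree. *)
Lemma sum_gridchar (g h : 'I_d -> nat) :
  (forall j, (g j < M)%N) -> (forall j, (h j < M)%N) ->
  \sum_al gridchar al g * (gridchar al h)^* =
  if [forall j, g j == h j] then M%:R ^+ d else 0.
Proof.
move=> gM hM.
pose c j : R := (g j)%:R - (h j)%:R.
have E al : gridchar al g * (gridchar al h)^* = expi2pi (\sum_j xi j * c j) *
    \prod_j expi2pi ((al j)%:R * (c j / M%:R)).
  rewrite /gridchar -[X in _ * X = _]/((expi2pi _)^*) -expi2piN -expi2pi_sum.
  rewrite -!expi2piD -sumrN -!big_split /=; congr expi2pi.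
  by apply: eq_bigr => j _; rewrite /c; ring.
under eq_bigr do rewrite E.
rewrite -mulr_sumr -(bigA_distr_bigA (fun (j : 'I_d) (a : 'I_M) =>
  expi2pi (a%:R * (c j / M%:R) : R))) /=.
under [X in _ * X]eq_bigr do rewrite sum_gridchar1 //.
case: forallP => [gh|/forallP].
  under [X in _ * X]eq_bigr => j _ do rewrite gh.
  rewrite big1 ?expi2pi0 ?mul1r ?prodr_const ?card_ord // => j _.
  by rewrite /c (eqP (gh j)) subrr mulr0.
rewrite negb_forall => /existsP[j /negPf gh].
by rewrite [X in _ * X](bigD1 j) //= gh mul0r mulr0.
Qed.

(** Parseval's identity. The right-hand side is free of [xi], which makes the later bounds uniform
    in the position of the cube. *)
Lemma sum_grid_normc_sqr (I : finType) (P : pred I) (h : I -> 'I_d -> nat) :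
  (forall i j, (h i j < M)%N) ->
  \sum_al normc (\sum_(i | P i) gridchar al (h i)) ^+ 2 =
  M%:R ^+ d * (#|[set p : I * I | [&& P p.1, P p.2 &
                     [forall j, h p.1 j == h p.2 j]]]|)%:R :> R.
Proof.
move=> hM; apply: (@complexI R); rewrite rmorph_sum /=.
under eq_bigr => al _.
  rewrite normc_sqr rmorph_sum big_distrlr /= pair_big /=.
  over.
rewrite exchange_big /=.
under eq_bigr => p _ do rewrite sum_gridchar //.
rewrite -big_mkcondr /= sumr_const rmorphM rmorphXn /= !rmorph_nat mulr_natr.
by congr (_ *+ _); apply: eq_card => p; rewrite !inE andbA.
Qed.

End grid.

(** * Power means and the broad-narrow dichotomy *)

Lemma power_mean (R : realDomainType) (I : finType) (t : I -> R) (n : nat) :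
  (forall i, 0 <= t i) ->
  (\sum_i t i) ^+ n.+1 <= #|I|%:R ^+ n * \sum_i t i ^+ n.+1.
Proof.
move=> t0; elim: n => [|n IH]; first by rewrite expr0 mul1r expr1.
rewrite exprS (le_trans (ler_wpM2l (sumr_ge0 _ _) IH)) //.
rewrite mulrCA exprSr -mulrA ler_wpM2l ?exprn_ge0 ?ler0n //.
have -> : #|I|%:R * \sum_i t i ^+ n.+2 = \sum_(i : I) \sum_(j : I) t j ^+ n.+2.
  by rewrite sumr_const mulr_natl.
(* Chebyshev's sum inequality: twice the difference is a double sum of products of two differences,
   which have the same sign because powers are monotone. *)
rewrite -subr_ge0 -(pmulrn_lge0 _ (isT : (0 < 2)%N)).
have -> : (\sum_(i : I) \sum_(j : I) t j ^+ n.+2 -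
      (\sum_i t i) * \sum_i t i ^+ n.+1) *+ 2 =
    \sum_(i : I) \sum_(j : I) (t i - t j) * (t i ^+ n.+1 - t j ^+ n.+1).
  pose A := \sum_(i : I) \sum_(j : I) t j ^+ n.+2.
  pose B := (\sum_i t i) * \sum_i t i ^+ n.+1.
  transitivity (A + A - (B + B)); first by rewrite /A /B mulr2n; ring.
  have AE : A = \sum_(i : I) \sum_(j : I) t i ^+ n.+2 by rewrite exchange_big.
  have BE : B = \sum_(i : I) \sum_(j : I) t i * t j ^+ n.+1.
    by rewrite /B big_distrlr.
  have BE' : B = \sum_(i : I) \sum_(j : I) t j * t i ^+ n.+1.
    by rewrite BE exchange_big.
  rewrite {1}AE {1}BE BE' /A -!big_split -sumrB /=.
  apply: eq_bigr => i _; rewrite -!big_split -sumrB /=.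
  by apply: eq_bigr => j _; rewrite !(exprS _ n.+1); ring.
apply: sumr_ge0 => i _; apply: sumr_ge0 => j _.
case: (lerP (t i) (t j)) => ij.
  by apply: mulr_le0; rewrite subr_le0 // lerXn2r ?nnegrE.
by apply: mulr_ge0; rewrite subr_ge0 ?lerXn2r ?nnegrE // ltW.
Qed.

(* Compare [#|B|] with [d], where [B] is the set of the [b] such that [t b] is at
   least [S / (2 l)]; the [b] outside [B] contribute at most [S / 2] in total. *)
Lemma broad_narrow (R : realFieldType) (l d k : nat) (t : 'I_l -> R) (S : R) :
  (0 < d)%N -> (0 < l)%N -> (forall b, 0 <= t b) -> 0 <= S -> S <= \sum_b t b ->
  S ^+ (2 * (k + d)) <=
    (2 * d%:R) ^+ (2 * (k + d)) * \sum_b t b ^+ (2 * (k + d)) +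
    (2 * l%:R) ^+ (2 * d) * \sum_(be : {ffun 'I_d -> 'I_l} | injectiveb be)
       (S ^+ (2 * k) * \prod_i t (be i) ^+ 2).
Proof.
move=> d0 l0 t0 S0 St.
have dr : 0 < d%:R :> R by rewrite ltr0n.
have lr : 0 < l%:R :> R by rewrite ltr0n.
have narrow_ge0 :
    0 <= (2 * d%:R) ^+ (2 * (k + d)) * \sum_b t b ^+ (2 * (k + d)).
  by rewrite mulr_ge0 ?exprn_ge0 ?mulr_ge0 ?ler0n // sumr_ge0 // => b _;
    rewrite exprn_ge0.
have broad_ge0 (be : {ffun 'I_d -> 'I_l}) :
    0 <= S ^+ (2 * k) * \prod_i t (be i) ^+ 2.
  by rewrite mulr_ge0 ?exprn_ge0 // prodr_ge0 // => i _; rewrite exprn_ge0.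
pose B := [set b | S <= 2 * l%:R * t b].
have [dB|Bd] := leqP d #|B|.
  apply: ler_wpDl => //.
  pose be : {ffun 'I_d -> 'I_l} := [ffun i => enum_val (widen_ord dB i)].
  have beinj : injectiveb be.
    apply/injectiveP => i j; rewrite !ffunE => /enum_val_inj /(congr1 val) /=.
    exact: val_inj.
  rewrite (bigD1 be) //= mulrDr; apply: ler_wpDr.
    by rewrite mulr_ge0 ?sumr_ge0 // exprn_ge0 // mulr_ge0 // ler0n.
  rewrite mulnDr exprD mulrCA ler_wpM2l ?exprn_ge0 //.
  have XE (x : R) : x ^+ (2 * d) = \prod_(i < d) x ^+ 2.
    by rewrite prodr_const card_ord exprM.
  rewrite !XE -big_split ler_prod // => i _.
  rewrite sqr_ge0 /= -exprMn lerXn2r ?nnegrE //.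
    by rewrite !mulr_ge0 ?ler0n.
  by have := enum_valP (widen_ord dB i); rewrite ffunE inE.
apply: ler_wpDr.
  by rewrite mulr_ge0 ?sumr_ge0 // exprn_ge0 // mulr_ge0 // ler0n.
suff [b Sb] : exists b, S <= 2 * d%:R * t b.
  rewrite (bigD1 b) //= mulrDr; apply: ler_wpDr.
    rewrite mulr_ge0 ?exprn_ge0 ?mulr_ge0 ?ler0n ?sumr_ge0 // => c _.
    by rewrite exprn_ge0.
  by rewrite -exprMn lerXn2r ?nnegrE // !mulr_ge0 ?ler0n.
have [SE|Spos] := eqVneq S 0.
  by exists (Ordinal l0); rewrite SE !mulr_ge0 ?ler0n.
(* Otherwise every [t b] is below [S / (2 d)]. The at most [d - 1] elements of [B] and the elements
   outside [B] then add up to at most [S - S / (2 d)], which is less than [S]. *)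
apply/existsP; rewrite -[X in is_true X]negbK negb_exists.
apply/negP => /forallP tS; have {}Spos : 0 < S by rewrite lt_neqAle eq_sym Spos.
move: St; apply/negP; rewrite -ltNge (bigID (mem B)) /=.
have H1 : \sum_(b in B) t b <= (d%:R - 1) * (S / (2 * d%:R)).
  apply: (@le_trans _ _ (\sum_(b in B) S / (2 * d%:R))).
    apply: ler_sum => b _; rewrite ler_pdivlMr ?mulr_gt0 // mulrC.
    by rewrite ltW // ltNge tS.
  rewrite sumr_const -[leLHS]mulr_natl ler_wpM2r ?divr_ge0 ?mulr_ge0 ?ler0n //.
  by rewrite lerBrDr natr1 ler_nat.
have H2 : \sum_(b | b \notin B) t b <= l%:R * (S / (2 * l%:R)).
  apply: (@le_trans _ _ (\sum_(b : 'I_l) S / (2 * l%:R))); last first.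
    by rewrite sumr_const card_ord -[leLHS]mulr_natl.
  rewrite big_mkcond ler_sum // => b _; case: ifP => [|_].
    rewrite inE -ltNge => /ltW tb; rewrite ler_pdivlMr ?mulr_gt0 //.
    by rewrite mulrC.
  by rewrite divr_ge0 ?mulr_ge0 ?ler0n.
apply: le_lt_trans (lerD H1 H2) _.
have -> : l%:R * (S / (2 * l%:R)) = S / 2 by field; rewrite gt_eqF.
have -> : (d%:R - 1) * (S / (2 * d%:R)) = S / 2 - S / (2 * d%:R).
  by field; rewrite gt_eqF.
have : 0 < S / (2 * d%:R) by rewrite divr_gt0 ?mulr_gt0.
lra.
Qed.

(** * Vinogradov's mean value *)

Definition psum (k N : nat) (x : {ffun 'I_k -> 'I_N}) (j : nat) : nat :=
  (\sum_i x i ^ j.+1)%N.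

(* Vinogradov's J_{k,d}(N), with variables in [0, N) instead of [1, N]. *)
Definition vinogradov (d k N : nat) : nat :=
  #|[set p : {ffun 'I_k -> 'I_N} * {ffun 'I_k -> 'I_N} |
     [forall j : 'I_d, psum p.1 j == psum p.2 j]]|.

(** This keeps the frequencies below [M], so that orthogonality on the grid detects equality and not
    only congruence mod [M]. *)
Lemma psum_ltn (d k N M : nat) (x : {ffun 'I_k -> 'I_N}) (j : 'I_d) :
  (k * N ^ d < M)%N -> (psum x j < M)%N.
Proof.
apply: leq_ltn_trans; rewrite /psum -[leqRHS](_ : \sum_(i < k) N ^ d = _)%N.
  apply: leq_sum => i _; have := ltn_ord (x i) => xi.
  apply: (@leq_trans (N ^ j.+1)); first by rewrite leq_exp2r // ltnW.
  by rewrite leq_pexp2l //; lia.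
by rewrite sum_nat_const card_ord.
Qed.

(** Variables in one class are [a + q z] with [z] at most [N %/ q], and by translation-dilation
    invariance the [z] solve the same system. *)
Lemma vinogradov_class (d k N q a : nat) : (0 < q)%N ->
  (#|[set p : {ffun 'I_k -> 'I_N} * {ffun 'I_k -> 'I_N} |
     [&& [forall i, p.1 i %% q == a], [forall i, p.2 i %% q == a] &
     [forall j : 'I_d, psum p.1 j == psum p.2 j]]]| <=
  vinogradov d k (N %/ q).+1)%N.
Proof.
move=> q0; set S := [set p | _].
pose f (x : {ffun 'I_k -> 'I_N}) : {ffun 'I_k -> 'I_(N %/ q).+1} :=
  [ffun i => inord (x i %/ q)].
have fE x i : f x i = (x i %/ q)%N :> nat.
  by rewrite ffunE inordK // ltnS leq_div2r // ltnW.
pose g (p : {ffun 'I_k -> 'I_N} * {ffun 'I_k -> 'I_N}) := (f p.1, f p.2).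
have xE (x : {ffun 'I_k -> 'I_N}) i :
    (x i %% q == a)%N -> x i = (a + q * f x i)%N :> nat.
  by move=> /eqP <-; rewrite fE addnC mulnC -divn_eq.
have fI (x y : {ffun 'I_k -> 'I_N}) :
    [forall i, x i %% q == a]%N -> [forall i, y i %% q == a]%N ->
    f x = f y -> x = y.
  move=> /forallP xa /forallP ya /ffunP fxy; apply/ffunP => i; apply/val_inj.
  by rewrite /= (xE x) // (xE y) // fxy.
have gI : {in S &, injective g}.
  move=> [x y] [z w]; rewrite !inE /= => /and3P[xa ya _] /and3P[za wa _].
  by case=> /fI -> // /fI ->.
rewrite -(card_in_imset gI); apply/subset_leq_card/fintype.subsetP => p.
move=> /imsetP[[x y]]; rewrite !inE /=.
move=> /and3P[/forallP xa /forallP ya /forallP xy] ->.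
have H := @power_sums_affine _ d a q (fun i => f x i : nat)
  (fun i => f y i : nat) q0.
have {}H : forall j, (j <= d)%N ->
    (\sum_i (f x i) ^ j = \sum_i (f y i) ^ j)%N.
  apply/H => -[_|j jd]; first by apply: eq_bigr => i _; rewrite !expn0.
  under eq_bigr do rewrite -xE //.
  under [RHS]eq_bigr do rewrite -xE //.
  exact: (eqP (xy (Ordinal jd))).
by apply/forallP => j; rewrite /psum H.
Qed.

Section grid_mean.
Context {R : realType} (d M : nat) (xi : 'I_d -> R).
Hypothesis M0 : (0 < M)%N.
Local Notation grid := {ffun 'I_d -> 'I_M}.

(** The predicate serves to select all variables, one residue class, or the positive integers. *)
Definition grid_sum N (al : grid) (A : pred 'I_N) : R[i] :=
  \sum_(x | A x) gridchar xi al (fun j => x ^ j.+1)%N.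

Lemma prod_grid_sum N k (al : grid) (A : 'I_k -> pred 'I_N) :
  \prod_i grid_sum al (A i) =
  \sum_(x : {ffun 'I_k -> 'I_N} | [forall i, A i (x i)])
     gridchar xi al (fun j => psum x j).
Proof.
rewrite /grid_sum bigA_distr_big_dep /=; apply: eq_big => [x|x _].
  by apply/familyP/forallP => H i; exact: H.
by rewrite -gridchar_sum.
Qed.

Lemma grid_sumX N k (al : grid) (A : pred 'I_N) :
  grid_sum al A ^+ k =
  \sum_(x : {ffun 'I_k -> 'I_N} | [forall i, A (x i)])
     gridchar xi al (fun j => psum x j).
Proof. by rewrite -(prod_grid_sum al (fun=> A)) prodr_const card_ord. Qed.

Lemma mean_grid_sumX N k (A : pred 'I_N) : (k * N ^ d < M)%N ->
  \sum_(al : grid) normc (grid_sum al A) ^+ (2 * k) =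
  M%:R ^+ d *
   #|[set p : {ffun 'I_k -> 'I_N} * {ffun 'I_k -> 'I_N} |
     [&& [forall i, A (p.1 i)], [forall i, A (p.2 i)] &
     [forall j : 'I_d, psum p.1 j == psum p.2 j]]]|%:R :> R.
Proof.
move=> HM.
rewrite -(@sum_grid_normc_sqr R d M xi M0 _ (fun x : {ffun 'I_k -> 'I_N} =>
  [forall i, A (x i)]) (fun x (j : 'I_d) => psum x j)); last first.
  by move=> x j; exact: (psum_ltn x j HM).
by apply: eq_bigr => al _; rewrite -grid_sumX normcX exprM exprAC.
Qed.

Lemma mean_grid_sumX_all N k : (k * N ^ d < M)%N ->
  \sum_(al : grid) normc (grid_sum al (@predT 'I_N)) ^+ (2 * k) =
  M%:R ^+ d * (vinogradov d k N)%:R :> R.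
Proof.
move=> HM; rewrite mean_grid_sumX //; congr (_ * _%:R).
apply: eq_card => p; rewrite !inE.
by apply/and3P/idP => [[]//|H]; split=> //; apply/forallP.
Qed.

Lemma mean_grid_sumX_class N k q a : (k * N ^ d < M)%N -> (0 < q)%N ->
  \sum_(al : grid) normc (grid_sum al [pred x : 'I_N | x %% q == a]%N) ^+ (2 * k)
    <= M%:R ^+ d * (vinogradov d k (N %/ q).+1)%:R :> R.
Proof.
move=> HM q0; rewrite mean_grid_sumX // ler_wpM2l ?exprn_ge0 ?ler0n //.
by rewrite ler_nat; exact: vinogradov_class.
Qed.

(* Whenever the equation [p(x) + p(z) = p(y) + p(w)] forces [tau x = tau y], the
   pieces of the sum over [x] on which [tau] is constant are orthogonal. *)
Lemma mean_grid_mixed N e k (T : finType) (P : pred {ffun 'I_e -> 'I_N})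
    (A : pred 'I_N) (tau : {ffun 'I_e -> 'I_N} -> T) (B : nat) :
  ((e + k) * N ^ d < M)%N ->
  (forall (x y : {ffun 'I_e -> 'I_N}) (z w : {ffun 'I_k -> 'I_N}), P x -> P y ->
     (forall i, A (z i)) -> (forall i, A (w i)) ->
     (forall j : 'I_d, psum x j + psum z j = psum y j + psum w j)%N ->
     tau x = tau y) ->
  (forall t, #|[set x | P x & tau x == t]| <= B)%N ->
  \sum_(al : grid) normc (\sum_(x | P x) gridchar xi al (fun j => psum x j)) ^+ 2 *
                   normc (grid_sum al A) ^+ (2 * k) <=
  (#|[set x | P x]| * B)%:R *
    \sum_(al : grid) normc (grid_sum al A) ^+ (2 * k) :> R.
Proof.
move=> HM Htau HB.
pose X := {ffun 'I_e -> 'I_N}; pose Z := {ffun 'I_k -> 'I_N}.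
pose PZ (z : Z) := [forall i, A (z i)].
pose h (p : X * Z) (j : 'I_d) := (psum p.1 j + psum p.2 j)%N.
have hM p j : (h p j < M)%N.
  apply: leq_ltn_trans HM; rewrite mulnDl.
  by rewrite leq_add // -ltnS; exact: (@psum_ltn d).
have prodE al (Q : pred X) :
    normc (\sum_(x | Q x) gridchar xi al (fun j => psum x j)) ^+ 2 *
    normc (grid_sum al A) ^+ (2 * k) =
    normc (\sum_(p : X * Z | Q p.1 && PZ p.2) gridchar xi al (h p)) ^+ 2 :> R.
  rewrite mulnC exprM -exprMn -normcX -normcM grid_sumX big_distrlr pair_big /=.
  by congr (normc _ ^+ 2); apply: eq_bigr => p _; rewrite -gridcharD.
pose Qt t : pred X := fun x => P x && (tau x == t).
(* By Parseval both sides count solutions. Each solution has the same [tau] on its two halves, so it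
   is found in the piece of that value. *)
apply: (@le_trans _ _ (\sum_(t : T) \sum_(al : grid)
   normc (\sum_(x | Qt t x) gridchar xi al (fun j => psum x j)) ^+ 2 *
                   normc (grid_sum al A) ^+ (2 * k))).
  under eq_bigr do rewrite prodE.
  under [X in _ <= X]eq_bigr => t _ do under eq_bigr do rewrite prodE.
  rewrite sum_grid_normc_sqr //.
  under [X in _ <= X]eq_bigr => t _ do rewrite sum_grid_normc_sqr //.
  rewrite -mulr_sumr ler_wpM2l ?exprn_ge0 ?ler0n // -natr_sum ler_nat.
  rewrite -sum1_card (partition_big (fun p => tau p.1.1) predT) //=.
  apply: leq_sum => t _; rewrite sum1_card subset_leq_card //.
  apply/fintype.subsetP => -[[x z] [y w]]; rewrite !inE /=.
  rewrite unfold_in /= inE /=.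
  move=> /andP[/and3P[/andP[Px Pz] /andP[Py Pw] /forallP E]].
  move=> xt; rewrite /Qt Px Py xt Pz Pw /=; apply/andP; split.
    rewrite -(eqP xt) andbT eq_sym; apply/eqP.
    apply: (Htau x y z w) => //; [exact/forallP|exact/forallP|].
    by move=> j; exact/eqP/E.
  exact/forallP.
rewrite mulr_sumr exchange_big /=.
apply: ler_sum => al _; rewrite -mulr_suml ler_wpM2r ?exprn_ge0 ?normc_ge0 //.
have -> : #|[set x | P x]| = (\sum_t #|[set x | P x & tau x == t]|)%N.
  rewrite -sum1_card (partition_big tau predT) //=; apply: eq_bigr => t _.
  by rewrite -sum1_card; apply: eq_bigl => x; rewrite !inE.
rewrite big_distrl /= natr_sum ler_sum // => t _.
(* The trivial bound for one piece: the square of its cardinality, one factor of which is at most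
   [B]. *)
apply: (@le_trans _ _ (#|[set x | P x & tau x == t]|%:R ^+ 2)).
  rewrite lerXn2r ?nnegrE ?normc_ge0 ?ler0n // (le_trans (le_normc_sum _ _ _)) //.
  under eq_bigr do rewrite normc_gridchar.
  rewrite sumr_const ler_nat subset_leq_card //.
  by apply/fintype.subsetP => x; rewrite inE.
by rewrite expr2 natrM ler_wpM2l ?ler0n // ler_nat.
Qed.

End grid_mean.

(** * Recursive inequalities for Vinogradov's mean value *)

Section recursion.
Context {R : realType}.

Lemma grid_sum_classes (d M N q : nat) (xi : 'I_d -> R)
    (al : {ffun 'I_d -> 'I_M}) : (0 < q)%N ->
  grid_sum xi al (@predT 'I_N) =
  \sum_(a < q) grid_sum xi al [pred x : 'I_N | x %% q == a]%N :> R[i].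
Proof.
move=> q0; rewrite /grid_sum.
rewrite (partition_big (fun x : 'I_N => Ordinal (ltn_pmod x q0)) predT) //=.

Qed.

Lemma mean_grid_sum1 (d M : nat) :
  \sum_(al : {ffun 'I_d -> 'I_M}) 1 = M%:R ^+ d :> R.
Proof. by rewrite sumr_const card_ffun !card_ord natrX. Qed.

(** Averaging [broad_narrow] over the grid. The narrow part has [l] classes, each a mean value of
    length about [N / l]; the broad part has at most [l ^ d] tuples of distinct classes, and
    bounding one of them by [C] is left to the base case and to the inductive step. *)
Lemma vinogradov_broad_narrow (d k l N M : nat) (xi : 'I_d -> R) (C : R) :
  (0 < d)%N -> (0 < l)%N -> ((d + k) * N ^ d < M)%N -> 0 <= C ->
  (forall be : {ffun 'I_d -> 'I_l}, injectiveb be ->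
    \sum_(al : {ffun 'I_d -> 'I_M})
      normc (grid_sum xi al (@predT 'I_N)) ^+ (2 * k) *
      normc (\prod_i grid_sum xi al [pred x : 'I_N | x %% l == be i]%N) ^+ 2 <=
    M%:R ^+ d * C :> R) ->
  (vinogradov d (k + d) N)%:R <=
    (2 * d%:R) ^+ (2 * (k + d)) * l%:R * (vinogradov d (k + d) (N %/ l).+1)%:R +
    (2 * l%:R) ^+ (2 * d) * l%:R ^+ d * C :> R.
Proof.
move=> d0 l0 HM C0 HC.
have M0 : (0 < M)%N by lia.
have Md0 : 0 < M%:R ^+ d :> R by rewrite exprn_gt0 ?ltr0n.
have HM' : ((k + d) * N ^ d < M)%N by rewrite addnC.
rewrite -(ler_pM2l Md0) -(mean_grid_sumX_all xi) //.
pose S (al : {ffun 'I_d -> 'I_M}) : R := normc (grid_sum xi al (@predT 'I_N)).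
pose g (al : {ffun 'I_d -> 'I_M}) (b : 'I_l) : R :=
  normc (grid_sum xi al [pred x : 'I_N | x %% l == b]%N).
apply: (@le_trans _ _ (\sum_(al : {ffun 'I_d -> 'I_M}) (
    (2 * d%:R) ^+ (2 * (k + d)) * \sum_b g al b ^+ (2 * (k + d)) +
    (2 * l%:R) ^+ (2 * d) * \sum_(be : {ffun 'I_d -> 'I_l} | injectiveb be)
       (S al ^+ (2 * k) * \prod_i g al (be i) ^+ 2)))).
  apply: ler_sum => al _; apply: broad_narrow => //.
  - by move=> b; exact: normc_ge0.
  - exact: normc_ge0.
  - by rewrite (@grid_sum_classes _ _ _ l xi) // le_normc_sum.
rewrite big_split /= mulrDr -!mulr_sumr; apply: lerD.
  rewrite -mulrA mulrCA ler_wpM2l ?exprn_ge0 ?mulr_ge0 ?ler0n //.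
  rewrite exchange_big /=.
  apply: (@le_trans _ _ (\sum_(b < l) M%:R ^+ d *
      (vinogradov d (k + d) (N %/ l).+1)%:R)); last first.
    by rewrite sumr_const card_ord -[leLHS]mulr_natl mulrCA.
  apply: ler_sum => b _.
  exact: mean_grid_sumX_class.
rewrite -mulrA mulrCA ler_wpM2l ?exprn_ge0 ?mulr_ge0 ?ler0n //.
rewrite exchange_big /= mulrCA.
apply: (@le_trans _ _ (\sum_(be : {ffun 'I_d -> 'I_l}) M%:R ^+ d * C)); last first.
  by rewrite sumr_const card_ffun !card_ord -[leLHS]mulr_natl natrX.
rewrite big_mkcond ler_sum // => be _; case: ifP => [/HC|_]; last first.
  by rewrite mulr_ge0 // ltW.
apply: le_trans; apply: ler_sum => al _.
by rewrite normc_prod -prodrXl.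
Qed.

Lemma card_class_tuples (d l N : nat) (b : 'I_d -> nat) :
  (#|[set x : {ffun 'I_d -> 'I_N} | [forall i, x i %% l == b i]]| <= N ^ d)%N.
Proof.
by rewrite (leq_trans (max_card _)) // card_ffun !card_ord.
Qed.

(** With [d] variables in distinct classes only diagonal solutions remain: [power_sums_lift] applies
    modulo any power of [l], and [l ^ N] exceeds [N]. Hence [tau] is the identity and its fibres
    have at most one element. *)
Lemma vinogradov_base (d l N : nat) :
  (0 < d)%N -> prime l -> (d < l)%N ->
  (vinogradov d d N)%:R <=
    (2 * d%:R) ^+ (2 * d) * l%:R * (vinogradov d d (N %/ l).+1)%:R +
    (2 * l%:R) ^+ (2 * d) * l%:R ^+ d * N%:R ^+ d :> R.
Proof.
move=> d0 pl dl; have l0 := prime_gt0 pl.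
pose xi : 'I_d -> R := fun=> 0; pose M := ((d + 0) * N ^ d).+1.
apply: (@vinogradov_broad_narrow d 0 l N M xi) => // be /injectiveP binj.
under eq_bigr do rewrite mulrC (prod_grid_sum _ _ (fun i => _)).
rewrite (le_trans (@mean_grid_mixed R d M xi isT N d 0 _
   (fun x : {ffun 'I_d -> 'I_N} => [forall i, x i %% l == be i]%N)
   predT id 1 _ _ _)) //.
- move=> x y z w /forallP xb /forallP yb _ _ E; apply/ffunP => i; apply/val_inj.
  have xy : (x i = y i %[mod l ^ N])%N.
    apply: (@power_sums_lift d l N (fun i => x i : nat) (fun i => y i : nat)) => //.
    + by move=> i'; rewrite (eqP (xb i')) (eqP (yb i')).
    + move=> i1 i2; rewrite (eqP (xb i1)) (eqP (xb i2)) => b12.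
      exact/binj/val_inj.
    + move=> j; have := E j; rewrite /psum !big_ord0 !addn0 => ->.
      by [].
  have Nl : (N < l ^ N)%N by rewrite ltn_expl // prime_gt1.
  by move: xy; rewrite !modn_small // (leq_trans _ (ltnW Nl)).
- move=> t; rewrite -(cards1 t) subset_leq_card //.
  by apply/fintype.subsetP => x; rewrite !inE => /andP[].
under eq_bigr do rewrite muln0 expr0.
rewrite mean_grid_sum1 muln1 mulrC ler_wpM2l ?exprn_ge0 ?ler0n //.
by rewrite -natrX ler_nat card_class_tuples.
Qed.

(** After a shift, the variables in the class of [a] contribute multiples of [q ^ j.+1] to the power
    sum of degree [j.+1]. The shifted power sums of the other [d] variables thus agree mod
    [q ^ j.+1], and Linnik's lemma bounds the fibres of [tau]. *)
Lemma mean_grid_class_tuples (d k l m N M a : nat) (xi : 'I_d -> R)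
    (be : {ffun 'I_d -> 'I_l}) :
  (0 < d)%N -> prime l -> (d < l)%N -> (N <= (l ^ m) ^ d)%N ->
  ((d + k) * N ^ d < M)%N -> (a < l ^ m)%N -> injective be ->
  \sum_(al : {ffun 'I_d -> 'I_M})
      normc (\prod_i grid_sum xi al [pred x : 'I_N | x %% l == be i]%N) ^+ 2 *
      normc (grid_sum xi al [pred x : 'I_N | x %% l ^ m == a]%N) ^+ (2 * k) <=
  M%:R ^+ d * (N%:R ^+ d * (l ^ m)%:R ^+ 'C(d, 2) *
     (vinogradov d k (N %/ l ^ m).+1)%:R) :> R.
Proof.
move=> d0 pl dl Nq HM aq binj; set q := (l ^ m)%N in Nq aq *.
have q0 n : (0 < q ^ n)%N by rewrite !expn_gt0 prime_gt0.
have M0 : (0 < M)%N by lia.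
have qd : (q <= q ^ d)%N by rewrite -[leqLHS]expn1 leq_pexp2l // (q0 1%N).
(* Shifting by [a'] makes the variables congruent to [a] divisible by [q]. *)
pose a' := (q ^ d - a)%N.
pose tau (x : {ffun 'I_d -> 'I_N}) : {ffun 'I_d -> 'I_(q ^ d).+1} :=
  [ffun j : 'I_d => inord ((\sum_i (x i + a') ^ j.+1) %% q ^ j.+1)].
have tauE x (j : 'I_d) :
    tau x j = ((\sum_i (x i + a') ^ j.+1) %% q ^ j.+1)%N :> nat.
  rewrite ffunE inordK // ltnS (leq_trans (ltnW (ltn_pmod _ (q0 _)))) //.
  by rewrite leq_pexp2l // (q0 1%N).
under eq_bigr do rewrite (prod_grid_sum _ _ (fun i => _)).
rewrite (le_trans (@mean_grid_mixed R d M xi M0 N d k _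
   (fun x : {ffun 'I_d -> 'I_N} => [forall i, x i %% l == be i]%N)
   [pred x : 'I_N | x %% q == a]%N tau (q ^ 'C(d, 2)) HM _ _)) //.
- move=> x y z w _ _ za wa E; apply/ffunP => j; apply/val_inj.
  rewrite [LHS]tauE [RHS]tauE.
  (* Pure translation by [a'] of all [d + k] variables together: [power_sums_affine] with dilation
     factor 1. *)
  pose I : finType := ('I_d + 'I_k)%type.
  pose u (x : {ffun 'I_d -> 'I_N}) (z : {ffun 'I_k -> 'I_N}) (i : I) : nat :=
    match i with inl i => x i | inr i => z i end.
  have H : forall j, (j <= d)%N ->
      (\sum_i (a' + 1 * u x z i) ^ j = \sum_i (a' + 1 * u y w i) ^ j)%N.
    apply/power_sums_affine => // -[_|j' j'd].
      by apply: eq_bigr => i _; rewrite !expn0.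
    by rewrite !big_sumType /=; exact: (E (Ordinal j'd)).
  have := H j.+1 (ltn_ord j); rewrite !big_sumType /=.
  have Z (v : {ffun 'I_k -> 'I_N}) :
      (forall i, [pred x : 'I_N | x %% q == a]%N (v i)) ->
      (q ^ j.+1 %| \sum_i (a' + 1 * v i) ^ j.+1)%N.
    move=> va; apply: dvdn_sum => i _; apply: dvdn_exp2r.
    have := divn_eq (v i) q; rewrite (eqP (va i)) => ->.
    rewrite mul1n /a' addnCA subnK ?(leq_trans (ltnW aq)) //.
    by rewrite dvdn_add ?dvdn_mull // dvdn_exp.
  move=> /(congr1 (fun n => n %% q ^ j.+1)%N).
  rewrite -modnDmr (eqP (Z z za)) addn0.
  rewrite -[in X in _ = X -> _]modnDmr (eqP (Z w wa)) addn0.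
  under eq_bigr do rewrite mul1n addnC.
  by under [in X in _ = X -> _]eq_bigr do rewrite mul1n addnC.
- move=> t; apply: leq_trans (@card_congruent_power_sums d l m N a'
    (fun i => be i : nat) (fun j => t j : nat) pl dl Nq _).
    apply/subset_leq_card/fintype.subsetP => x; rewrite !inE.
    move=> /andP[/forallP xb /eqP xt]; apply/andP; split.
      by apply/forallP => i; rewrite (eqP (xb i)) modn_small.
    by apply/forallP => j; rewrite -xt tauE modn_mod.
  move=> i i'; rewrite !modn_small // => ii; exact/binj/val_inj.
have HM' : (k * N ^ d < M)%N.
  by apply: leq_ltn_trans HM; rewrite leq_mul // leq_addl.
rewrite (le_trans (ler_wpM2l _ (mean_grid_sumX_class xi M0 a HM' (q0 1%N)))) //.
rewrite mulrCA ler_wpM2l ?exprn_ge0 ?ler0n // ler_wpM2r ?ler0n //.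
rewrite natrM natrX ler_wpM2r ?exprn_ge0 ?ler0n //.
by rewrite -natrX ler_nat card_class_tuples.
Qed.

(** Hoelder's inequality over the [q = l ^ m] classes costs [q ^ (2 k - 1)], and the sum over the
    classes one more factor [q]. *)
Lemma vinogradov_step (d k l m N : nat) :
  (0 < d)%N -> (0 < k)%N -> prime l -> (d < l)%N -> (N <= (l ^ m) ^ d)%N ->
  (vinogradov d (k + d) N)%:R <=
    (2 * d%:R) ^+ (2 * (k + d)) * l%:R * (vinogradov d (k + d) (N %/ l).+1)%:R +
    (2 * l%:R) ^+ (2 * d) * l%:R ^+ d * ((l ^ m)%:R ^+ (2 * k) *
      (N%:R ^+ d * (l ^ m)%:R ^+ 'C(d, 2) *
        (vinogradov d k (N %/ l ^ m).+1)%:R)) :> R.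
Proof.
move=> d0 k0 pl dl Nq; have l0 := prime_gt0 pl.
pose xi : 'I_d -> R := fun=> 0; pose M := ((d + k) * N ^ d).+1.
apply: (@vinogradov_broad_narrow d k l N M xi) => // be /injectiveP binj.
set q := (l ^ m)%N in Nq *; set C := (X in _ * (_ * X)).
have q0 : (0 < q)%N by rewrite expn_gt0 l0.
apply: (@le_trans _ _ (\sum_(al : {ffun 'I_d -> 'I_M}) q%:R ^+ (2 * k).-1 *
   \sum_(a < q)
     (normc (\prod_i grid_sum xi al [pred x : 'I_N | x %% l == be i]%N) ^+ 2 *
      normc (grid_sum xi al [pred x : 'I_N | x %% q == a]%N) ^+ (2 * k)))).
  apply: ler_sum => al _; rewrite mulrC -mulr_sumr mulrCA.
  rewrite ler_wpM2l ?exprn_ge0 ?normc_ge0 //.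
  rewrite (@grid_sum_classes _ _ _ q xi) //.
  pose t (a : 'I_q) : R := normc (grid_sum xi al [pred x : 'I_N | x %% q == a]%N).
  have t0 a : 0 <= t a by exact: normc_ge0.
  have := power_mean (2 * k).-1 t0; rewrite card_ord prednK ?muln_gt0 //.
  by apply: le_trans; rewrite lerXn2r ?nnegrE ?normc_ge0 ?le_normc_sum // sumr_ge0.
rewrite -mulr_sumr exchange_big /=.
apply: (@le_trans _ _ (q%:R ^+ (2 * k).-1 * \sum_(a < q) M%:R ^+ d * C)).
  rewrite ler_wpM2l ?exprn_ge0 ?ler0n // ler_sum // => a _.
  exact: mean_grid_class_tuples.
have E : (2 * k)%N = (2 * k).-1.+1 by rewrite prednK // muln_gt0.
rewrite sumr_const card_ord /C [in leRHS]E exprSr le_eqVlt; apply/orP; left.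
by rewrite -[X in _ * X == _]mulr_natl; apply/eqP; ring.
Qed.

End recursion.

(** * Solving the recursion: the mean value theorem *)

Section growth.
Context {R : realType}.

Lemma powR_ge1 (a x : R) : 1 <= a -> 0 <= x -> 1 <= a `^ x.
Proof. by move=> a1 x0; rewrite -(powRr0 a) ler_powR. Qed.

(** For [N >= l] the new argument is at most [2 N / l]. As [lam >= 2], the recursive term is at most
    [C1 * 2 ^ lam / l] times the claimed bound, hence at most half of it; the other half absorbs
    [C2]. *)
Lemma growth_recursion (J : nat -> R) (lam C1 C2 : R) (l : nat) :
  (forall n, 0 <= J n) -> 2 <= lam -> 0 <= C1 -> 0 <= C2 -> (3 <= l)%N ->
  2 * C1 * 2 `^ lam <= l%:R ->
  (forall N, (0 < N)%N ->
    J N <= C1 * l%:R * J (N %/ l).+1 + C2 * N%:R `^ lam) ->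
  exists2 A : R, 0 <= A & forall N, (0 < N)%N -> J N <= A * N%:R `^ lam.
Proof.
move=> J0 lam2 C10 C20 l3 lC HJ.
have l0 : 0 < l%:R :> R by rewrite ltr0n; lia.
pose A := 2 * C2 + \sum_(n < l) J n.
have A0 : 0 <= A by rewrite addr_ge0 ?mulr_ge0 ?sumr_ge0.
exists A => //; elim/ltn_ind => N IH N0.
have Nlam : 1 <= N%:R `^ lam by rewrite powR_ge1 ?ler1n //; lra.
have [Nl|lN] := ltnP N l.
  apply: (@le_trans _ _ A); last by rewrite ler_peMr.
  rewrite /A (bigD1 (Ordinal Nl)) //= addrCA lerDl.
  by rewrite addr_ge0 ?mulr_ge0 ?sumr_ge0.
set n := (N %/ l).+1.
(* Here [3 <= l] matters: for [l = N = 2] the argument would not decrease. *)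
have nN : (n < N)%N by rewrite /n; have := leq_trunc_div N l; nia.
have nr : n%:R <= 2 * N%:R / l%:R :> R.
  rewrite ler_pdivlMr // -natrM -natrM ler_nat /n mulSn.
  by have := leq_trunc_div N l; lia.
have Jn : J n <= A * (2 `^ lam * N%:R `^ lam / l%:R ^+ 2).
  apply: (le_trans (IH n nN _)) => //; rewrite ler_wpM2l //.
  apply: (@le_trans _ _ ((2 * N%:R / l%:R) `^ lam)).
    by rewrite ge0_ler_powR ?nnegrE ?ler0n ?divr_ge0 ?mulr_ge0 ?ler0n //; lra.
  rewrite powRM ?mulr_ge0 ?invr_ge0 ?ler0n // powRM ?ler0n //.
  rewrite ler_wpM2l ?mulr_ge0 ?powR_ge0 //.
  rewrite -powR_inv1 ?ler0n // -powRrM mulN1r powRN lef_pV2 ?posrE ?powR_gt0 //.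
    by rewrite -powR_mulrn ?ler0n // ler_powR // ler1n; lia.
  by rewrite exprn_gt0.
apply: (le_trans (HJ N N0)); rewrite -/n.
have H1 : C1 * l%:R * J n <= A / 2 * N%:R `^ lam.
  apply: (le_trans (ler_wpM2l (mulr_ge0 C10 (ltW l0)) Jn)).
  have -> : C1 * l%:R * (A * (2 `^ lam * N%:R `^ lam / l%:R ^+ 2)) =
     (2 * C1 * 2 `^ lam) / l%:R * (A / 2 * N%:R `^ lam).
    by field; rewrite gt_eqF.
  rewrite ler_piMl ?mulr_ge0 ?divr_ge0 ?powR_ge0 ?ler0n //.
  by rewrite ler_pdivrMr // mul1r.
have H2 : C2 <= A / 2.
  by rewrite ler_pdivlMr // mulrC /A lerDl sumr_ge0.
apply: (le_trans (lerD H1 (ler_wpM2r (powR_ge0 _ _) H2))).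
by rewrite -mulrDl -splitr.
Qed.

Definition mean_exponent (d k : nat) : R :=
  2 * k%:R * d%:R - s_of R d + d%:R ^+ 2 / 2 * (1 - d%:R^-1) ^+ k.

Lemma mean_exponent1 (d : nat) : (0 < d)%N -> mean_exponent d 1 = d%:R.
Proof.
move=> d0; have dr : d%:R != 0 :> R by rewrite pnatr_eq0 -lt0n.
by rewrite /mean_exponent /s_of; field.
Qed.

(** The terms are the exponents of the factors in [vinogradov_step] for [k d] restricted variables
    and [q = N^(1/d)]: the Hoelder loss, the choice of [d] variables, Linnik's lemma, and the mean
    value at length [N^(1 - 1/d)]. *)
Lemma mean_exponentS (d k : nat) : (0 < d)%N ->
  mean_exponent d k.+1 =
  2 * k%:R + d%:R + (d%:R - 1) / 2 + (1 - d%:R^-1) * mean_exponent d k.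
Proof.
move=> d0; have dr : d%:R != 0 :> R by rewrite pnatr_eq0 -lt0n.
by rewrite /mean_exponent /s_of (exprS _ k) -(natr1 k); field.
Qed.

(** Supplies the lower bound 2 on the exponent for [growth_recursion]. Each increment is [2 d] minus
    at most [d / 2]. *)
Lemma mean_exponent_ge (d k : nat) : (0 < d)%N -> d%:R <= mean_exponent d k.+1.
Proof.
move=> d0; have d1 : 1 <= d%:R :> R by rewrite ler1n.
have r01 : 0 <= 1 - (d%:R^-1 : R) <= 1.
  by rewrite subr_ge0 invf_le1 ?ltr0n // d1 gerBl invr_ge0 ler0n.
elim: k => [|k IH]; first by rewrite mean_exponent1.
apply: (le_trans IH).
have rk : (1 - d%:R^-1) ^+ k.+1 <= 1 :> R by case/andP: r01 => *; rewrite exprn_ile1.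
have -> : mean_exponent d k.+2 = mean_exponent d k.+1 + 2 * d%:R -
    d%:R / 2 * (1 - d%:R^-1) ^+ k.+1.
  rewrite /mean_exponent (exprS _ k.+1) -(natr1 k.+1).
  by field; rewrite gt_eqF // ltr0n.
nra.
Qed.

Lemma large_prime (d : nat) (x : R) :
  exists l : nat, [/\ prime l, (d < l)%N, (3 <= l)%N & x <= l%:R].
Proof.
have [l ml pl] := prime_above (maxn (maxn d 3) (Num.truncn x).+1).
move: ml; rewrite !gtn_max -andbA => /and3P[dl l3 xl].
exists l; split => //; first exact: ltnW.
by rewrite (le_trans (ltW (truncnS_gt x))) // ler_nat ltnW.
Qed.

Theorem vinogradov_mean_value (d k : nat) : (2 <= d)%N ->
  exists2 A : R, 0 <= A & forall N, (0 < N)%N ->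
    (vinogradov d (k.+1 * d) N)%:R <= A * N%:R `^ mean_exponent d k.+1.
Proof.
move=> d2; have d0 : (0 < d)%N by lia.
have dr0 : d%:R != 0 :> R by rewrite pnatr_eq0 -lt0n.
have dge2 : 2 <= d%:R :> R by rewrite ler_nat.
have exp2 j : 2 <= mean_exponent d j.+1.
  by rewrite (le_trans _ (mean_exponent_ge _ _)).
elim: k => [|k [A A0 IH]].
  rewrite mul1n mean_exponent1 //.
  pose C1 : R := (2 * d%:R) ^+ (2 * d).
  have [l [pl dl l3 lC]] := large_prime d (2 * C1 * 2 `^ d%:R).
  have C10 : 0 <= C1 by rewrite exprn_ge0 ?mulr_ge0 ?ler0n.
  apply: (@growth_recursion (fun N => (vinogradov d d N)%:R) d%:R C1
     ((2 * l%:R) ^+ (2 * d) * l%:R ^+ d) l) => //.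
  move=> N N0; rewrite powR_mulrn ?ler0n //.
  exact: vinogradov_base.
set K := (k.+1 * d)%N in IH; have -> : (k.+2 * d = K + d)%N by rewrite /K; lia.
have K0 : (0 < K)%N by rewrite muln_gt0.
set lam := mean_exponent d k.+1 in IH; set lam' := mean_exponent d k.+2.
(* The prime [l] is chosen in terms of [d] and [k] only, so its powers go into the constant [C2]. *)
pose C1 : R := (2 * d%:R) ^+ (2 * (K + d)).
have [l [pl dl l3 lC]] := large_prime d (2 * C1 * 2 `^ lam').
have C10 : 0 <= C1 by rewrite exprn_ge0 ?mulr_ge0 ?ler0n.
have l1 : (1 < l)%N by lia.
have lr : 0 < l%:R :> R by rewrite ltr0n; lia.
pose C2 : R := (2 * l%:R) ^+ (2 * d) * l%:R ^+ d *
   (l%:R ^+ (2 * K) * l%:R ^+ 'C(d, 2) * (A * 2 `^ lam)).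
have C20 : 0 <= C2.
  by rewrite /C2 !mulr_ge0 ?exprn_ge0 ?mulr_ge0 ?ler0n ?powR_ge0.
apply: (@growth_recursion (fun N => (vinogradov d (K + d) N)%:R) lam' C1 C2 l) => //.
  exact: exp2.
move=> N N0.
have N1 : 1 <= N%:R :> R by rewrite ler1n.
(* The modulus [l ^ m] lies between [N^(1/d)] and [l N^(1/d)]. *)
pose m := up_log (l ^ d) N.
have ld1 : (1 < l ^ d)%N by rewrite -[X in (X < _)%N](expn0 l) ltn_exp2l.
have Nq : (N <= (l ^ m) ^ d)%N by rewrite -expnM mulnC expnM up_logP.
have qN : ((l ^ m) ^ d <= l ^ d * N)%N.
  rewrite -expnM mulnC expnM /m.
  have [->|N2] := eqVneq N 1%N; first by rewrite up_log1 expn0 muln1 ltnW.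
  have N3 : (1 < N)%N by lia.
  have /andP[H _] := up_log_bounds ld1 N3.
  have mpos : (0 < up_log (l ^ d) N)%N by rewrite up_log_gt0 ld1.
  by rewrite -(prednK mpos) expnS leq_mul // ltnW.
apply: (le_trans (vinogradov_step d0 K0 pl dl Nq)).
rewrite lerD2l; set q := (l ^ m)%N in Nq qN *.
have q0 : (0 < q)%N by rewrite expn_gt0; lia.
have qr0 : 0 < q%:R :> R by rewrite ltr0n.
have qE : q%:R = (q%:R ^+ d) `^ d%:R^-1 :> R.
  by rewrite -powR_mulrn ?ler0n // -powRrM mulfV // powRr1 ?ler0n.
have dV0 : 0 <= d%:R^-1 :> R by rewrite invr_ge0 ler0n.
have qup : q%:R <= l%:R * N%:R `^ d%:R^-1 :> R.
  rewrite qE; apply: (@le_trans _ _ ((l ^ d * N)%:R `^ d%:R^-1)).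
    rewrite ge0_ler_powR ?nnegrE ?exprn_ge0 ?ler0n //.
    by rewrite -natrX ler_nat.
  rewrite natrM powRM ?ler0n // natrX -powR_mulrn ?ler0n // -powRrM mulfV //.
  by rewrite powRr1 // ler0n.
have qlo : N%:R `^ d%:R^-1 <= q%:R :> R.
  rewrite qE ge0_ler_powR ?nnegrE ?ler0n ?exprn_ge0 ?ler0n //.
  by rewrite -natrX ler_nat.
have qpow e : q%:R ^+ e <= l%:R ^+ e * N%:R `^ (e%:R / d%:R) :> R.
  apply: (@le_trans _ _ ((l%:R * N%:R `^ d%:R^-1) ^+ e)).
    by rewrite lerXn2r ?nnegrE ?mulr_ge0 ?powR_ge0 ?ler0n.
  rewrite exprMn ler_wpM2l ?exprn_ge0 ?ler0n //.
  by rewrite -powR_mulrn ?powR_ge0 // -powRrM mulrC.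
(* As [q] is at least [N^(1/d)], the length [N %/ q + 1] is at most [2 N^(1 - 1/d)]. *)
have Jq : (vinogradov d K (N %/ q).+1)%:R <=
    A * (2 `^ lam * N%:R `^ ((1 - d%:R^-1) * lam)) :> R.
  apply: (le_trans (IH (N %/ q).+1 isT)); rewrite ler_wpM2l //.
  rewrite powRrM -powRM ?powR_ge0 // ge0_ler_powR
    ?nnegrE ?mulr_ge0 ?powR_ge0 ?ler0n //.
    by rewrite (le_trans _ (exp2 k)).
  rewrite -natr1 -[2]/(1 + 1) mulrDl mul1r lerD //.
    apply: (@le_trans _ _ (N%:R / q%:R)).
      by rewrite ler_pdivlMr // -natrM ler_nat leq_trunc_div.
    rewrite ler_pdivrMr // powRD; last by rewrite pnatr_eq0 -lt0n N0 implybT.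
    rewrite powRr1 ?ler0n // powRN -mulrA ler_peMr ?ler0n //.
    by rewrite mulrC ler_pdivlMr ?mul1r // powR_gt0 // ltr0n.
  rewrite powR_ge1 // subr_ge0 invf_le1 ?ltr0n //; lra.
rewrite /C2 -[leRHS]mulrA ler_wpM2l ?mulr_ge0 ?exprn_ge0 ?mulr_ge0 ?ler0n //.
have NX : N%:R ^+ d = N%:R `^ d%:R :> R by rewrite powR_mulrn ?ler0n.
apply: (@le_trans _ _ ((l%:R ^+ (2 * K) * N%:R `^ ((2 * K)%:R / d%:R)) *
  (N%:R `^ d%:R * (l%:R ^+ 'C(d, 2) * N%:R `^ ('C(d, 2)%:R / d%:R)) *
   (A * (2 `^ lam * N%:R `^ ((1 - d%:R^-1) * lam)))))).
  rewrite NX; apply: ler_pM => //;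
    rewrite ?exprn_ge0 ?mulr_ge0 ?powR_ge0 ?exprn_ge0 ?ler0n //.
  apply: ler_pM => //; rewrite ?exprn_ge0 ?mulr_ge0 ?powR_ge0 ?exprn_ge0 ?ler0n //.
  by rewrite ler_wpM2l ?powR_ge0.
have Nn0 : N%:R != 0 :> R by rewrite pnatr_eq0 -lt0n.
have -> : lam' = (2 * K)%:R / d%:R + (d%:R + ('C(d, 2)%:R / d%:R +
    (1 - d%:R^-1) * lam)).
  rewrite /lam' mean_exponentS // -/lam.
  have -> : 'C(d, 2)%:R = d%:R * (d%:R - 1) / 2 :> R.
    have : ('C(d, 2) * 2 = d * d.-1)%N.
      by rewrite -[X in (_ * X)%N]/(2`!) bin_ffact ffactnS ffactn1.
    move=> /(congr1 (fun n => n%:R : R)); rewrite !natrM.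
    by have -> : d.-1%:R = d%:R - 1 :> R by [rewrite -subn1 natrB|]; lra.
  by rewrite !natrM; field.
have ND x y : N%:R `^ (x + y) = N%:R `^ x * N%:R `^ y :> R.
  by rewrite powRD // Nn0 implybT.
rewrite !ND le_eqVlt; apply/orP; left; apply/eqP; ring.
Qed.

End growth.

(** * From integrals to grid averages *)

Local Open Scope classical_set_scope.
Local Open Scope ring_scope.

Section integral.
Context {R : realType}.

Lemma normcE_sqrt (z : R[i]) :
  normc z = Num.sqrt (complex.Re z ^+ 2 + complex.Im z ^+ 2).
Proof. by case: z. Qed.

(** The squared distance is [2 (1 - cos (2 pi t))], so continuity of the cosine at 0 with tolerance
    [eta^2 / 2] is enough. *)
Lemma expi2pi_near1 (eta : R) : 0 < eta ->
  exists2 e : R, 0 < e & forall t, `|t| < e -> normc (expi2pi t - 1) < eta.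
Proof.
move=> eta0.
have /cvgrPdist_lt /(_ (eta ^+ 2 / 2)) := @continuous_cos R 0.
rewrite divr_gt0 ?exprn_gt0 // => /(_ isT) /nbhs_ballP[e /= e0 He].
have p2 : 0 < 2 * pi :> R by rewrite mulr_gt0 ?pi_gt0.
exists (e / (2 * pi)) => [|t]; first by rewrite divr_gt0.
rewrite ltr_pdivlMr // => te.
have := He (2 * pi * t); rewrite /ball /= sub0r normrN normrM gtr0_norm //.
rewrite mulrC => /(_ te); rewrite cos0 => Hc.
have {Hc} : 1 - cos (2 * pi * t) < eta ^+ 2 / 2 by exact: le_lt_trans (ler_norm _) Hc.
move=> Hc; rewrite -(ltr_pXn2r (n := 2)) ?nnegrE ?normc_ge0 ?(ltW eta0) //.
rewrite sqr_sqrtr ?addr_ge0 ?sqr_ge0 //=.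
have := cos2Dsin2 (2 * pi * t); move: Hc; rewrite subr0.
set c := cos _; set s := sin _; nra.
Qed.

Lemma measurable_weyl_sum_powR (d N : nat) (p : R) :
  measurable_fun [set: d.-tuple (measurableTypeR R)]
    (fun x : d.-tuple R => normc (weyl_sum x N) `^ p).
Proof.
have mt n : measurable_fun [set: d.-tuple (measurableTypeR R)]
    (fun x : d.-tuple R => 2 * pi * \sum_(j < d) tnth x j * n%:R ^+ j.+1 : R).
  apply: measurable_funM => //; apply: measurable_sum => j.
  by apply: measurable_funM => //; exact: measurable_tnth.
apply: (measurableT_comp (measurable_powR p)).
under eq_fun do rewrite normcE_sqrt.
apply: (measurableT_comp (continuous_measurable_fun (@sqrt_continuous R))).
apply: measurable_funD; apply: measurable_funX.
  rewrite (_ : (fun _ => _) = (fun x : d.-tuple R => \sum_(n <- index_iota 1 N.+1)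
      cos (2 * pi * \sum_(j < d) tnth x j * n%:R ^+ j.+1))).
    apply: measurable_sum => n.
    exact: (measurableT_comp (continuous_measurable_fun (@continuous_cos R))).
  by apply/funext => x; rewrite /weyl_sum raddf_sum.
rewrite (_ : (fun _ => _) = (fun x : d.-tuple R => \sum_(n <- index_iota 1 N.+1)
    sin (2 * pi * \sum_(j < d) tnth x j * n%:R ^+ j.+1))).
  apply: measurable_sum => n.
  exact: (measurableT_comp (continuous_measurable_fun (@continuous_sin R))).
by apply/funext => x; rewrite /weyl_sum raddf_sum.
Qed.

Definition box (d : nat) (a b : d.-tuple R) : set (d.-tuple R) :=
  [set x | forall j, tnth a j <= tnth x j <= tnth b j].

Lemma measurable_box (d : nat) (a b : d.-tuple R) :
  measurable (box a b : set (d.-tuple (measurableTypeR R))).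
Proof.
rewrite (_ : box a b = \bigcap_(i in [set: 'I_d])
  ((fun x : d.-tuple (measurableTypeR R) => tnth x i) @^-1`
    `[tnth a i, tnth b i])).
  apply: fin_bigcap_measurable => // i _.
  rewrite -[X in measurable X]setTI; exact: measurable_tnth.
apply/seteqP; split => x /= H i.
  by move=> _; have := H i; rewrite /= in_itv.
by have := H i Logic.I; rewrite /= in_itv.
Qed.

(** The values 0 and 1 of [e] give the lower and the upper corner of the cell of [al]. *)
Definition grid_point (d M : nat) (xi : d.-tuple R) (al : {ffun 'I_d -> 'I_M})
    (e : nat) : d.-tuple R :=
  [tuple tnth xi j + (al j + e)%:R / M%:R | j < d].

(** An upper Riemann sum: the closed cells cover the unit cube at [xi], hence the cube of side
    [delta], and each has volume [M ^ (- d)]. *)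
Lemma integral_cube_le (d M : nat) (xi : d.-tuple R) (delta : R)
    (F : d.-tuple R -> R) (c : {ffun 'I_d -> 'I_M} -> R) :
  (0 < M)%N -> delta <= 1 ->
  measurable_fun [set: d.-tuple (measurableTypeR R)] F ->
  (forall x, 0 <= F x) -> (forall al, 0 <= c al) ->
  (forall al x, box (grid_point xi al 0) (grid_point xi al 1) x -> F x <= c al) ->
  (\int[lebesgue_tuple R d]_(x in cube xi delta) (F x)%:E <=
   ((\sum_al c al) / M%:R ^+ d)%:E)%E.
Proof.
move=> M0 d1 mF F0 c0 Fc.
have Mr : 0 < M%:R :> R by rewrite ltr0n.
pose B (al : {ffun 'I_d -> 'I_M}) : set (d.-tuple R) :=
  box (grid_point xi al 0) (grid_point xi al 1).
have mB al : measurable (B al : set (d.-tuple (measurableTypeR R))).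
  exact: measurable_box.
have cubeE : cube xi delta = box xi [tuple tnth xi j + delta | j < d].
  by apply/seteqP; split => x /= H j; have := H j; rewrite !tnth_mktuple.
have mC : measurable (cube xi delta : set (d.-tuple (measurableTypeR R))).
  by rewrite cubeE; exact: measurable_box.
have cover x : cube xi delta x -> exists al, B al x.
  move=> Hx.
  have H j : exists a : 'I_M,
      a%:R / M%:R <= tnth x j - tnth xi j <= a.+1%:R / M%:R.
    have /andP[x0 xd] := Hx j.
    pose y := (tnth x j - tnth xi j) * M%:R.
    have y0 : 0 <= y by rewrite mulr_ge0 ?subr_ge0 // ltW.
    have yM : y <= M%:R by rewrite /y ler_piMl ?ler0n //; lra.
    have /andP[t1 t2] := truncn_itv y0.
    have [tM|Mt] := ltnP (Num.truncn y) M.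
      exists (Ordinal tM); rewrite ler_pdivrMr // ler_pdivlMr // -/y t1.
      exact: ltW.
    (* Only the endpoint [y = M] remains; it belongs to the last cell. *)
    have pM : (M.-1 < M)%N by rewrite prednK.
    exists (Ordinal pM) => /=; rewrite ler_pdivrMr // ler_pdivlMr // -/y
      prednK // yM.
    by rewrite andbT (le_trans _ t1) // ler_nat (leq_trans _ Mt) // leq_pred.
  have [f Hf] := choice H.
  exists [ffun j => f j] => j; rewrite !tnth_mktuple ffunE addn0 addn1.
  by have /andP[] := Hf j; rewrite lerBrDl lerBlDl => -> ->.
apply: (@le_trans _ _ (\int[lebesgue_tuple R d]_(x in cube xi delta)
    (\sum_(al : {ffun 'I_d -> 'I_M}) (c al)%:E * (\1_(B al) x)%:E)))%E.
  apply: ge0_le_integral => //.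
  - by move=> x _; rewrite lee_fin.
  - by apply/measurable_EFinP; apply: measurable_funTS.
  - apply: emeasurable_sum => al; apply: measurable_funTS.
    apply: emeasurable_funM => //.
    by apply/measurable_EFinP; exact: measurable_indic.
  move=> x /cover[al Bx]; rewrite (bigD1 al) //= indicE mem_set // mule1.
  rewrite lee_paddr ?lee_fin ?Fc //.
  by rewrite sume_ge0 // => be _; rewrite mule_ge0 ?lee_fin.
rewrite ge0_integral_sum //; last 2 first.
- move=> al; apply: measurable_funTS; apply: emeasurable_funM => //.
  by apply/measurable_EFinP; exact: measurable_indic.
- by move=> al x _; rewrite mule_ge0 ?lee_fin.
rewrite mulr_suml -sumEFin; apply: lee_sum => al _.
rewrite ge0_integralZl_EFin //; last first.
  by apply: measurable_funTS; apply/measurable_EFinP; exact: measurable_indic.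
rewrite EFinM lee_wpmul2l ?lee_fin // integral_indic //.
apply: (@le_trans _ _ (lebesgue_tuple R d (B al))).
  apply: le_measure; rewrite ?inE //; exact: measurableI.
rewrite lebesgue_tuple_box => [|j]; last first.
  by rewrite !tnth_mktuple lerD2l ler_pM2r ?invr_gt0 // ler_nat addn0 addn1.
rewrite lee_fin (eq_bigr (fun=> M%:R^-1)) ?prodr_const ?card_ord ?exprVn // => j _.
by rewrite !tnth_mktuple addn0 addn1 -natr1; field; rewrite gt_eqF.
Qed.

End integral.

Section local_mean_value.
Context {R : realType}.

(** The variables from 1 to [N] are the nonzero elements of ['I_N.+1], whence the mean values at
    [N.+1]. *)
Lemma weyl_sum_grid_point (d M N : nat) (xi : d.-tuple R)
    (al : {ffun 'I_d -> 'I_M}) :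
  weyl_sum (grid_point xi al 0) N =
  grid_sum (tnth xi) al [pred x : 'I_N.+1 | 0 < x]%N.
Proof.
rewrite /grid_sum big_mkcond big_ord_recl /= add0r /weyl_sum big_add1 big_mkord.
apply: eq_bigr => i _; rewrite /gridchar /=; congr expi2pi.
by apply: eq_bigr => j _; rewrite tnth_mktuple addn0 natrX.
Qed.

(** Within a cell each phase moves by at most [d N^d / M'], so for large [M'] each of the [N] terms
    moves by at most [1 / (N + 1)]. A mesh this fine costs nothing, since the normalized grid means
    do not depend on it. *)
Lemma weyl_sum_box (d N : nat) : exists2 M : nat, (0 < M)%N & forall M',
  (M <= M')%N -> forall (xi : d.-tuple R) (al : {ffun 'I_d -> 'I_M'}) x,
  box (grid_point xi al 0) (grid_point xi al 1) x ->
  normc (weyl_sum x N) <= normc (weyl_sum (grid_point xi al 0) N) + 1.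
Proof.
have N1 : 0 < N.+1%:R^-1 :> R by rewrite invr_gt0 ltr0n.
have [e e0 He] := expi2pi_near1 N1.
exists (Num.truncn ((d * N ^ d)%:R / e : R)).+1 => // M' MM xi al x Hx.
set y := grid_point xi al 0.
have Mr : 0 < M'%:R :> R by rewrite ltr0n; lia.
rewrite -[weyl_sum x N](subrK (weyl_sum y N)) addrC.
rewrite (le_trans (le_normcD _ _)) // lerD2l /weyl_sum -sumrB.
rewrite (le_trans (le_normc_sum _ _ _)) //.
have xy j : `|tnth x j - tnth y j| <= M'%:R^-1.
  have := Hx j; rewrite /y !tnth_mktuple addn0 addn1 -natr1 mulrDl mul1r.
  by move=> /andP[x0 x1]; rewrite ger0_norm; lra.
apply: (@le_trans _ _ (\sum_(1 <= n < N.+1) N.+1%:R^-1)); last first.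
  rewrite sumr_const_nat subn1 /= -[leLHS]mulr_natl ler_pdivrMr ?ltr0n //.
  by rewrite mul1r ler_nat.
rewrite !big_nat; apply: ler_sum => n /andP[n1 nN].
set t := \sum_j _; set u := \sum_j _.
have -> : expi2pi t - expi2pi u = expi2pi u * (expi2pi (t - u) - 1).
  by rewrite mulrBr mulr1 -expi2piD [u + _]addrC subrK.
rewrite normcM normc_expi2pi mul1r; apply/ltW/He.
apply: (@le_lt_trans _ _ ((d * N ^ d)%:R / M'%:R)); last first.
  rewrite ltr_pdivrMr // -ltr_pdivrMl // mulrC.
  by rewrite (lt_le_trans (truncnS_gt _)) // ler_nat.
rewrite /t /u -sumrB (le_trans (ler_norm_sum _ _ _)) //.
apply: (@le_trans _ _ (\sum_(j < d) (N ^ d)%:R / M'%:R)).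
  apply: ler_sum => j _; rewrite -mulrBl normrM mulrC ler_pM //.
  rewrite ger0_norm ?exprn_ge0 ?ler0n // -natrX ler_nat.
  apply: (@leq_trans (N ^ j.+1)); first by rewrite leq_exp2r.
  by rewrite leq_pexp2l //; lia.
by rewrite sumr_const card_ord -[leLHS]mulr_natl natrM mulrA.
Qed.

Lemma mean_weyl_sum_grid (d M N k : nat) (xi : d.-tuple R) :
  (0 < M)%N -> (k * N.+1 ^ d < M)%N ->
  \sum_(al : {ffun 'I_d -> 'I_M})
     normc (weyl_sum (grid_point xi al 0) N) ^+ (2 * k) <=
  M%:R ^+ d * (vinogradov d k N.+1)%:R.
Proof.
move=> M0 HM; under eq_bigr do rewrite weyl_sum_grid_point.
rewrite mean_grid_sumX // ler_wpM2l ?exprn_ge0 ?ler0n // ler_nat.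
apply/subset_leq_card/fintype.subsetP => p; rewrite !inE.
by move=> /and3P[].
Qed.

Lemma normc_weyl_sum_le (d N : nat) (x : d.-tuple R) :
  normc (weyl_sum x N) <= N%:R.
Proof.
rewrite (le_trans (le_normc_sum _ _ _)) //.
under eq_bigr do rewrite normc_expi2pi.
by rewrite sumr_const_nat subn1.
Qed.

Lemma exprD1_le (t : R) (n : nat) : 0 <= t ->
  (t + 1) ^+ n <= 2 ^+ n * (t ^+ n + 1).
Proof.
move=> t0; have [t1|t1] := leP t 1.
  apply: (@le_trans _ _ (2 ^+ n)); first by rewrite lerXn2r ?nnegrE //; lra.
  by rewrite ler_peMr ?exprn_ge0 // lerDr exprn_ge0.
apply: (@le_trans _ _ ((2 * t) ^+ n)).
  by rewrite lerXn2r ?nnegrE //; lra.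
by rewrite exprMn ler_wpM2l ?exprn_ge0 // lerDl.
Qed.

(** Even integer moments are what the grid can count. Two of them allow interpolation; [b = 0]
    leaves plain truncation. The terms [+ 1] pay for the variation of the sum on a cell. *)
Lemma local_mean_value_le (s : R) (d N K1 K2 : nat) (a b delta : R)
    (xi : d.-tuple R) :
  0 <= a -> 0 <= b -> delta <= 1 ->
  (forall t, 0 <= t <= N%:R ->
     t `^ (2 * s) <= a * t ^+ (2 * K1) + b * t ^+ (2 * K2)) ->
  (local_mean_value s delta xi N <=
   (a * 2 ^+ (2 * K1) * ((vinogradov d K1 N.+1)%:R + 1) +
    b * 2 ^+ (2 * K2) * ((vinogradov d K2 N.+1)%:R + 1))%:E)%E.
Proof.
move=> a0 b0 d1 Hab; have [M' M0' HM'] := weyl_sum_box d N.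
pose M := (M' + (K1 + K2) * N.+1 ^ d).+1.
have HM : (M' <= M)%N by rewrite /M; lia.
have M0 : (0 < M)%N by [].
have HK1 : (K1 * N.+1 ^ d < M)%N by rewrite /M; nia.
have HK2 : (K2 * N.+1 ^ d < M)%N by rewrite /M; nia.
have Md : 0 < M%:R ^+ d :> R by rewrite exprn_gt0 // ltr0n.
pose phi (al : {ffun 'I_d -> 'I_M}) : R :=
  normc (weyl_sum (grid_point xi al 0) N).
have phi0 al : 0 <= phi al by exact: normc_ge0.
pose c al := a * (2 ^+ (2 * K1) * (phi al ^+ (2 * K1) + 1)) +
  b * (2 ^+ (2 * K2) * (phi al ^+ (2 * K2) + 1)).
have c0 al : 0 <= c al.
  by rewrite addr_ge0 // !mulr_ge0 ?exprn_ge0 // addr_ge0 ?exprn_ge0.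
rewrite /local_mean_value.
apply: le_trans (@integral_cube_le R d M xi delta
  (fun x => normc (weyl_sum x N) `^ (2 * s)) c M0 d1 _ _ c0 _) _.
- exact: measurable_weyl_sum_powR.
- by move=> x; exact: powR_ge0.
- move=> al x Hx; apply: (le_trans (Hab _ _)).
    by rewrite normc_ge0 normc_weyl_sum_le.
  have Hphi := HM' M HM xi al x Hx.
  have H n : normc (weyl_sum x N) ^+ n <= 2 ^+ n * (phi al ^+ n + 1).
    apply: (le_trans _ (exprD1_le n (phi0 al))).
    by rewrite lerXn2r ?nnegrE ?normc_ge0 // addr_ge0.
  by rewrite lerD // ler_wpM2l.
rewrite lee_fin ler_pdivrMr // /c big_split /= -!mulr_sumr !big_split /=.
rewrite mean_grid_sum1 mulrDl -!mulrA.
have HJ K : (K * N.+1 ^ d < M)%N ->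
    \sum_al phi al ^+ (2 * K) + M%:R ^+ d <=
    ((vinogradov d K N.+1)%:R + 1) * M%:R ^+ d.
  move=> HK; rewrite mulrDl mul1r lerD2r mulrC; exact: mean_weyl_sum_grid.
by apply: lerD; rewrite !ler_wpM2l ?exprn_ge0 // HJ.
Qed.

End local_mean_value.

(** * Exponents *)

Section exponents.
Context {R : realType}.

(** The second-order term matters: the linear Bernoulli bound is in general too weak for
    [saving_base]. *)
Lemma bernoulli2 (h : R) (n : nat) : 0 <= h ->
  1 + n%:R * h + n%:R * (n%:R - 1) / 2 * h ^+ 2 <= (1 + h) ^+ n.
Proof.
move=> h0; elim: n => [|n IH]; first by rewrite expr0; lra.
rewrite (exprS _ n) (le_trans _ (ler_wpM2l _ IH)) ?addr_ge0 //.
have n0 : 0 <= n%:R * (n%:R - 1) :> R.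
  by case: n {IH} => [|n]; rewrite ?mul0r // -natr1 addrK mulr_ge0 ?addr_ge0.
have -> : (1 + h) * (1 + n%:R * h + n%:R * (n%:R - 1) / 2 * h ^+ 2) =
  1 + n.+1%:R * h + n.+1%:R * (n.+1%:R - 1) / 2 * h ^+ 2 +
  n%:R * (n%:R - 1) / 2 * h ^+ 3 by rewrite -(natr1 n); field.
by rewrite lerDl mulr_ge0 ?exprn_ge0 // divr_ge0.
Qed.

(* Says that [(1 - 1/d)^k / 2 <= s(d) / (2 s + d^2 + 1)] at [s = (k+1) d], hence
   for all smaller [s]. *)
Definition saving (d k : nat) : Prop :=
  (1 - d%:R^-1) ^+ k * (2 * k.+1%:R * d%:R + d%:R ^+ 2 + 1) <=
    d%:R * (d%:R + 1) :> R.

(** One more factor [1 - 1/d] outweighs the increase [2 d] of the other factor. *)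
Lemma savingS (d k : nat) : (0 < d)%N -> (d <= k)%N -> saving d k -> saving d k.+1.
Proof.
move=> d0 dk; apply: le_trans; rewrite exprSr -mulrA ler_wpM2l //.
  by rewrite exprn_ge0 // subr_ge0 invf_le1 ?ltr0n ?ler1n.
have dr : 0 < d%:R :> R by rewrite ltr0n.
have dkr : d%:R <= k%:R :> R by rewrite ler_nat.
rewrite -(ler_pM2l dr) mulrA mulrBr mulr1 mulfV ?gt_eqF // -!(natr1 k.+1) -!(natr1 k).
nra.
Qed.

Lemma saving_ge (d k0 k : nat) : (0 < d)%N -> (d <= k0)%N -> (k0 <= k)%N ->
  saving d k0 -> saving d k.
Proof.
move=> d0 dk0 /subnK <-; elim: (k - k0)%N => [|n IH] H; first by rewrite add0n.
by rewrite addSn; apply: savingS => //; [lia|exact: IH].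
Qed.

(** At [k = 2 d - 1] the second factor is [5 d^2 + 1], and the inverse of the first,
    [(1 + 1/(d-1)) ^ k], is at least [(5 d - 3) / (d - 1)] by [bernoulli2]. *)
Lemma saving_base (d : nat) : (2 <= d)%N -> saving d (2 * d).-1.
Proof.
move=> d2; rewrite /saving prednK; last by lia.
have dr : 2 <= d%:R :> R by rewrite ler_nat.
set x : R := d%:R in dr *; pose h : R := (x - 1)^-1.
have h0 : 0 <= h by rewrite invr_ge0; lra.
have := bernoulli2 (2 * d).-1 h0.
have -> : ((2 * d).-1)%:R = 2 * x - 1 :> R.
  by rewrite -subn1 natrB ?natrM //; lia.
have -> : 1 + (2 * x - 1) * h + (2 * x - 1) * (2 * x - 1 - 1) / 2 * h ^+ 2 =
    (5 * x - 3) / (x - 1) by rewrite /h; field; rewrite gt_eqF //; lra.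
set n := (2 * d).-1; rewrite natrM -/x => H.
have E : (1 - x^-1) ^+ n * (1 + h) ^+ n = 1.
  rewrite -exprMn (_ : _ * _ = 1) ?expr1n // /h; field.
  by apply/andP; split; rewrite gt_eqF //; lra.
have r0 : 0 <= (1 - x^-1) ^+ n.
  by rewrite exprn_ge0 // subr_ge0 invf_le1; lra.
have H' : (1 - x^-1) ^+ n * (5 * x - 3) <= x - 1.
  rewrite -[leRHS]mul1r -ler_pdivrMr; last by lra.
  by rewrite -mulrA -[leRHS]E ler_wpM2l.
move: H'; set r := _ ^+ n in r0 *; nra.
Qed.

(** At [k = 2] the condition fails, as [4/9 * 28 > 12]; hence the separate treatment of [s <= 9] for
    [d = 3]. *)
Lemma saving3 : saving 3 3.
Proof. rewrite /saving; lra. Qed.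

Lemma vinogradov_succ_le (d k : nat) : (2 <= d)%N ->
  exists2 A : R, 0 <= A & forall N, (0 < N)%N ->
    (vinogradov d (k.+1 * d) N.+1)%:R + 1 <= A * N%:R `^ mean_exponent d k.+1.
Proof.
move=> d2; have [A A0 HA] := @vinogradov_mean_value R d k d2.
set lam := mean_exponent d k.+1 in HA *.
have lam0 : 0 <= lam.
  by rewrite (le_trans _ (mean_exponent_ge _ _)) //; lia.
exists (A * 2 `^ lam + 1) => [|N N0].
  by rewrite addr_ge0 // mulr_ge0 // powR_ge0.
rewrite mulrDl mul1r lerD //; last by rewrite powR_ge1 // ler1n.
rewrite (le_trans (HA _ _)) // -mulrA ler_wpM2l // -powRM ?ler0n //.
rewrite ge0_ler_powR ?nnegrE ?mulr_ge0 ?ler0n //.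
by rewrite -natrM ler_nat; lia.
Qed.

Lemma powR_split (t x : R) (n : nat) : 0 < t -> t `^ x = t `^ (x - n%:R) * t ^+ n.
Proof.
move=> t0; rewrite -[t ^+ n]powR_mulrn ?(ltW t0) // -powRD ?subrK //.
by rewrite (gt_eqF t0) implybT.
Qed.

(** The first term alone suffices for [t <= T], the second for [t > T], where [x - n] is a
    nonpositive exponent. *)
Lemma powR_interpolate (t T x : R) (m n : nat) : 0 <= t -> 0 < T -> 0 < x ->
  m%:R <= x -> x <= n%:R ->
  t `^ x <= T `^ (x - m%:R) * t ^+ m + T `^ (x - n%:R) * t ^+ n.
Proof.
move=> t0 T0 x0 mx xn; have H p k : 0 <= T `^ p * t ^+ k.
  by rewrite mulr_ge0 ?powR_ge0 ?exprn_ge0.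
move: t0; rewrite le_eqVlt => /predU1P[<-|t0].
  by rewrite powR0 ?gt_eqF // addr_ge0 // mulr_ge0 ?powR_ge0 ?exprn_ge0.
have [tT|Tt] := leP t T.
  apply: ler_wpDr => //; rewrite (powR_split _ m t0) ler_wpM2r ?exprn_ge0 ?(ltW t0) //.
  by rewrite ge0_ler_powR ?nnegrE ?subr_ge0 // ltW.
apply: ler_wpDl => //; rewrite (powR_split _ n t0) ler_wpM2r ?exprn_ge0 ?(ltW t0) //.
rewrite -[x - _]opprB !powRN lef_pV2 ?posrE ?powR_gt0 //.
by rewrite ge0_ler_powR ?nnegrE ?subr_ge0 // ltW.
Qed.

Lemma powR_le_trunc (t T x : R) (m : nat) : 0 <= t -> t <= T -> 0 < x -> m%:R <= x ->
  t `^ x <= T `^ (x - m%:R) * t ^+ m.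
Proof.
move=> t0 tT x0 mx; move: t0; rewrite le_eqVlt => /predU1P[t0|t0].
  by rewrite -t0 powR0 ?gt_eqF // mulr_ge0 ?powR_ge0 ?exprn_ge0.
rewrite (powR_split _ m t0) ler_wpM2r ?exprn_ge0 ?(ltW t0) //.
by rewrite ge0_ler_powR ?nnegrE ?subr_ge0 // ltW // (lt_le_trans t0).
Qed.

(* The exponent obtained from the theorem by replacing [delta ^+ d] with its
   smallest admissible value. *)
Definition target_exponent (d : nat) (s : R) : R :=
  2 * s - s_of R d + d%:R ^+ 2 * (s_of R d / (2 * s + d%:R ^+ 2 + 1)).

Definition unit_cube_bound (d : nat) (s : R) : Prop :=
  exists C : R, forall N, (0 < N)%N -> forall (delta : R) (xi : d.-tuple R),
    delta <= 1 ->
    (local_mean_value s delta xi N <= (C * N%:R `^ target_exponent d s)%:E)%E.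

(** * Bounds over the unit cube *)

Lemma unit_cube_bound_trunc (d k : nat) (s : R) : (2 <= d)%N ->
  k.+1%:R * d%:R <= s -> s <= k.+2%:R * d%:R -> saving d k.+1 ->
  unit_cube_bound d s.
Proof.
move=> d2 ks sk sav; have [A A0 HA] := vinogradov_succ_le k d2.
have dr : 2 <= d%:R :> R by rewrite ler_nat.
have s0 : 0 < s.
  by rewrite (lt_le_trans _ ks) // mulr_gt0 //; lra.
pose K := (k.+1 * d)%N.
exists (2 ^+ (2 * K) * A) => N N0 delta xi delta1.
have N1 : 1 <= N%:R :> R by rewrite ler1n.
have Nn0 : N%:R != 0 :> R by rewrite gt_eqF //; lra.
have KE : (2 * K)%:R = 2 * k.+1%:R * d%:R :> R by rewrite !natrM mulrA.
pose a : R := N%:R `^ (2 * s - (2 * K)%:R).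
apply: (le_trans (@local_mean_value_le R s d N K 0 a 0 delta xi _ _ delta1 _)) => //.
- exact: powR_ge0.
- move=> t /andP[t0 tN]; rewrite mul0r addr0.
  apply: powR_le_trunc => //; first by rewrite mulr_gt0.
  by rewrite KE -mulrA ler_wpM2l.
rewrite lee_fin !mul0r addr0.
apply: (@le_trans _ _ (a * 2 ^+ (2 * K) * (A * N%:R `^ mean_exponent d k.+1))).
  by rewrite ler_wpM2l ?HA // mulr_ge0 ?powR_ge0 ?exprn_ge0.
have -> : a * 2 ^+ (2 * K) * (A * N%:R `^ mean_exponent d k.+1) =
   2 ^+ (2 * K) * A * (a * N%:R `^ mean_exponent d k.+1) by ring.
rewrite ler_wpM2l ?mulr_ge0 ?exprn_ge0 // /a -powRD ?Nn0 ?implybT //.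
apply: ler_powR => //; rewrite KE /mean_exponent /target_exponent.
have V0 : 0 < 2 * s + d%:R ^+ 2 + 1 by nra.
(* The right-hand side decreases in [s], so [saving] at the upper endpoint [(k + 2) d] covers the
   whole range. *)
suff : (1 - d%:R^-1) ^+ k.+1 / 2 <= s_of R d / (2 * s + d%:R ^+ 2 + 1).
  set r := _ ^+ k.+1; set q := s_of R d / _ => rq.
  have : d%:R ^+ 2 * (r / 2) <= d%:R ^+ 2 * q by rewrite ler_wpM2l // sqr_ge0.
  lra.
rewrite ler_pdivlMr // /s_of mulrAC ler_pM2r ?invr_gt0 //.
apply: le_trans sav; rewrite ler_wpM2l //.
  by rewrite exprn_ge0 // subr_ge0 invf_le1; lra.
by rewrite -mulrA !lerD2r; lra.
Qed.

Lemma unit_cube_bound_cubic (s : R) : 7 < s -> s <= 9 -> unit_cube_bound 3 s.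
Proof.
move=> s7 s9.
have [A A0 HA] := @vinogradov_succ_le 3 1 isT.
have [B B0 HB] := @vinogradov_succ_le 3 2 isT.
have eA : mean_exponent 3 2 = 8 :> R by rewrite /mean_exponent /s_of; field.
have eB : mean_exponent 3 3 = 40 / 3 :> R by rewrite /mean_exponent /s_of; field.
rewrite eA in HA; rewrite eB in HB.
exists (2 ^+ 12 * A + 2 ^+ 18 * B) => N N0 delta xi delta1.
have N1 : 1 <= N%:R :> R by rewrite ler1n.
have Nn0 : N%:R != 0 :> R by rewrite gt_eqF //; lra.
(* The two terms of the interpolation are equal for this [T]. *)
pose T : R := N%:R `^ (8 / 9).
have T0 : 0 < T by rewrite powR_gt0; lra.
apply: (le_trans (@local_mean_value_le R s 3 N 6 9 (T `^ (2 * s - 12%:R))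
  (T `^ (2 * s - 18%:R)) delta xi _ _ delta1 _)) => //; rewrite ?powR_ge0 //.
- by move=> t /andP[t0 tN]; apply: powR_interpolate => //; lra.
rewrite lee_fin.
have TE x : T `^ x = N%:R `^ (8 / 9 * x) by rewrite /T -powRrM.
(* The exponent 8/9 in [T] is [(40/3 - 8) / (18 - 12)], from the bounds for the 12th and the 18th
   moment. *)
have E : 8 / 9 * (2 * s - 12%:R) + 8 <= target_exponent 3 s.
  rewrite /target_exponent /s_of.
  have V0 : 0 < 2 * s + 3%:R ^+ 2 + 1 by lra.
  suff : 8 / 3 * (5 / 4) - 2 * s / 9 <=
    3%:R ^+ 2 * (3%:R * (3%:R + 1) / 2 / (2 * s + 3%:R ^+ 2 + 1)) by lra.
  rewrite !mulrA ler_pdivlMr //; nra.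
have H (p q : R) : 8 / 9 * p + q <= target_exponent 3 s ->
    T `^ p * N%:R `^ q <= N%:R `^ target_exponent 3 s.
  by move=> pq; rewrite TE -powRD ?Nn0 ?implybT // ler_powR.
rewrite [leRHS]mulrDl; apply: lerD.
  apply: (@le_trans _ _ (T `^ (2 * s - 12%:R) * 2 ^+ 12 * (A * N%:R `^ 8))).
    by rewrite ler_wpM2l ?HA // mulr_ge0 ?powR_ge0 ?exprn_ge0.
  have -> : T `^ (2 * s - 12%:R) * 2 ^+ 12 * (A * N%:R `^ 8) =
    2 ^+ 12 * A * (T `^ (2 * s - 12%:R) * N%:R `^ 8) by ring.
  by rewrite ler_wpM2l ?H // mulr_ge0 ?exprn_ge0.
apply: (@le_trans _ _ (T `^ (2 * s - 18%:R) * 2 ^+ 18 * (B * N%:R `^ (40 / 3)))).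
  by rewrite ler_wpM2l ?HB // mulr_ge0 ?powR_ge0 ?exprn_ge0.
have -> : T `^ (2 * s - 18%:R) * 2 ^+ 18 * (B * N%:R `^ (40 / 3)) =
  2 ^+ 18 * B * (T `^ (2 * s - 18%:R) * N%:R `^ (40 / 3)) by ring.
rewrite ler_wpM2l ?H // ?mulr_ge0 ?exprn_ge0 //; lra.
Qed.

Lemma unit_cube_bound_large (d : nat) (s : R) :
  (3 <= d)%N ->
  (s_of R d * (minn (2 ^ (d - 1)) (2 * d * (d - 1)))%:R - d%:R ^+ 2 - 1) / 2 < s ->
  unit_cube_bound d s.
Proof.
move=> d3 sD.
have dr : 3 <= d%:R :> R by rewrite ler_nat.
have trunc k0 : (d <= k0)%N -> saving d k0 -> k0%:R * d%:R <= s ->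
    unit_cube_bound d s.
  move=> dk0 sav ks; pose k := Num.truncn (s / d%:R).
  have sd0 : 0 <= s / d%:R.
    by rewrite divr_ge0 ?ler0n // (le_trans _ ks) // mulr_ge0 ?ler0n.
  have /andP[k1 k2] := truncn_itv sd0.
  have k0k : (k0 <= k)%N by rewrite truncn_ge_nat // ler_pdivlMr //; lra.
  have kpos : (0 < k)%N by lia.
  have kE : k.-1.+1 = k by rewrite prednK.
  apply: (@unit_cube_bound_trunc d k.-1) => //; rewrite ?kE; first by lia.
  - by rewrite -ler_pdivlMr //; lra.
  - by rewrite ltW // -ltr_pdivrMr //; lra.
  - by apply: saving_ge sav => //; lia.
have [d4|d4] := leqP 4 d.
  apply: (@trunc (2 * d).-1); first by lia.
    by apply: saving_base; lia.
  (* With this bound the hypothesis gives [s > (d^3 - 1) / 2], which is at least [(2 d - 1) d] for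
     [d >= 4]. *)
  have D2d : (2 * d <= minn (2 ^ (d - 1)) (2 * d * (d - 1)))%N.
    rewrite leq_min; apply/andP; split; last by nia.
    elim: d d4 {d3 sD dr trunc} => // d IH; rewrite leq_eqVlt => /predU1P[<- //|d4].
    have -> : (2 ^ (d.+1 - 1) = 2 * 2 ^ (d - 1))%N.
      by rewrite -expnS; congr (_ ^ _)%N; lia.
    by move/IH: d4; lia.
  have Dr : 2 * d%:R <= (minn (2 ^ (d - 1)) (2 * d * (d - 1)))%:R :> R.
    by rewrite -natrM ler_nat.
  have d4r : 4 <= d%:R :> R by rewrite ler_nat.
  have -> : ((2 * d).-1)%:R = 2 * d%:R - 1 :> R.
    by rewrite -subn1 natrB ?natrM //; lia.
  apply: le_trans (ltW sD); rewrite ler_pdivlMr // /s_of.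
  set D := (minn _ _)%:R in Dr *; set x := d%:R in dr d4r Dr *.
  have : x * (x + 1) / 2 * (2 * x) <= x * (x + 1) / 2 * D.
    by rewrite ler_wpM2l // divr_ge0 // mulr_ge0; lra.
  nra.
have dE : d = 3%N by lia.
have [s9|s9] := leP s 9; last first.
  apply: (@trunc 3%N); rewrite dE //; first exact: saving3.
  lra.
(* For [d = 3] the minimum is 4 and the threshold for [s] is 7. *)
rewrite dE; apply: unit_cube_bound_cubic => //.
by move: sD; rewrite dE /s_of /minn /=; lra.
Qed.

End exponents.

Theorem theorem3p8 (R : realType) (d : nat) (s : R)
  (D := minn (2 ^ (d - 1)) (2 * d * (d - 1))) :
  (3 <= d)%N ->
  (s_of R d * D%:R - d%:R ^+ 2 - 1) / 2 < s ->
  forall eps : R, 0 < eps ->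
  exists N0 : nat, forall N : nat, (1 <= N)%N -> (N0 <= N)%N ->
  forall delta : R,
    N%:R `^ (- ((d%:R + 1) / (2 * (2 * s + d%:R ^+ 2 + 1)))) <= delta ->
    delta <= 1 ->
    (sup_local_mean_value s d delta N <=
      (delta ^+ d *
       N%:R `^ (2 * s * (1 - s_of R d / (2 * s + d%:R ^+ 2 + 1)) + eps))%:E)%E.
Proof.
move=> d3 sD eps eps0.
have [C HC] := unit_cube_bound_large d3 sD.
have dr : 3 <= d%:R :> R by rewrite ler_nat.
have V0 : 0 < 2 * s + d%:R ^+ 2 + 1.
  have : 0 <= s_of R d * D%:R.
    by rewrite mulr_ge0 ?ler0n // /s_of divr_ge0 // mulr_ge0; lra.
  by move: sD; rewrite ltr_pdivrMr //; lra.
(* From here on [N^eps] absorbs the constant [C]. *)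
exists (Num.truncn (`|C| `^ eps^-1)).+1 => N N0 CN delta deltaN delta1.
have Nr : 0 < N%:R :> R by rewrite ltr0n.
have CNeps : C <= N%:R `^ eps.
  apply: (le_trans (ler_norm _)).
  have -> : `|C| = (`|C| `^ eps^-1) `^ eps.
    by rewrite -powRrM mulVf ?powRr1 // lt0r_neq0.
  rewrite ge0_ler_powR ?nnegrE ?powR_ge0 ?(ltW eps0) //.
  by rewrite (le_trans (ltW (truncnS_gt _))) // ler_nat.
apply: ub_ereal_sup => _ [xi _ <-].
apply: (le_trans (HC N N0 delta xi delta1)); rewrite lee_fin.
apply: (@le_trans _ _ (N%:R `^ eps * N%:R `^ target_exponent d s)).
  by rewrite ler_wpM2r ?powR_ge0.
have Nn0 : N%:R != 0 :> R by rewrite gt_eqF.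
pose kap := s_of R d / (2 * s + d%:R ^+ 2 + 1).
apply: (@le_trans _ _ (N%:R `^ (- kap) *
   N%:R `^ (2 * s * (1 - kap) + eps))).
  rewrite -!powRD ?Nn0 ?implybT // le_eqVlt; apply/orP; left; apply/eqP.
  congr (_ `^ _); rewrite /target_exponent /kap; field.
  by rewrite gt_eqF.
rewrite ler_wpM2r ?powR_ge0 //.
(* As [s(d) = d (d + 1) / 2], the [d]-th power of the lower bound on [delta] is [N^(- kap)]. *)
rewrite (_ : - kap = - ((d%:R + 1) / (2 * (2 * s + d%:R ^+ 2 + 1))) * d%:R).
  by rewrite powRrM powR_mulrn ?powR_ge0 // lerXn2r ?nnegrE ?powR_ge0 //
    (le_trans _ deltaN) // powR_ge0.
by rewrite /kap /s_of; field; rewrite gt_eqF.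
Qed.
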